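(* Suppose the pair $(p_{XY},p_{Z|XY})$ is in normal form. Then any secure protocol $\Pi(p_{XY},p_{Z|XY})$ satisfies \begin{align*} H(M_{23}) &\ge \max\{RI(X;Z),RI(X;Y)\}+H(Y,Z|X),\\ H(M_{31}) &\ge \max\{RI(Y;Z),RI(X;Y)\}+H(X,Z|Y),\\ H(M_{12}) &\ge \max\{RI(X;Z),RI(Y;Z)\}+H(X,Y|Z), \end{align*} where all quantities are computed under the joint distribution $p_{XY}(x,y)p_{Z|XY}(z|x,y)$ and the protocol.
   Context: Setting: $\mathcal X,\mathcal Y,\mathcal Z$ are finite sets. Alice (party 1) holds input $X\in\mathcal X$, Bob (party 2) holds $Y\in\mathcal Y$, with $(X,Y)\sim p_{XY}$; Charlie (party 3) has no input and outputs $Z\in\mathcal Z$. A randomized function is a conditional distribution $p_{Z|XY}$. In a protocol the three parties, each using private randomness, exchange messages over multiple rounds on three pairwise private links; each message on a link is a codeword of a prefix-free code determined by the previous messages on that link, and the protocol terminates with probability 1; it may depend on $p_{XY}$. $M_{12},M_{23},M_{31}$ are the final transcripts on the Alice–Bob, Bob–Charlie, Charlie–Alice links. A secure protocol $\Pi(p_{XY},p_{Z|XY})$ satisfies: (correctness) on inputs $x,y$ Charlie's output is distributed as $p_{Z|X=x,Y=y}$; (privacy) the Markov chains $(M_{12},M_{31})-X-(Y,Z)$, $(M_{12},M_{23})-Y-(X,Z)$, $(M_{23},M_{31})-Z-(X,Y)$ hold. Normal form of a pair: for $x,x'$ let $S_{x,x'}=\{y: p_{XY}(x,y)>0, p_{XY}(x',y)>0\}$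 and say $x\cong x'$ if $p(z|x,y)=p(z|x',y)$ for all $y\in S_{x,x'}$, $z\in\mathcal Z$; define $y\cong y'$ symmetrically; say $z\cong z'$ if there is $c\ge0$ with $p(z|x,y)=c\,p(z'|x,y)$ for all $(x,y)$ with $p_{XY}(x,y)>0$. The pair is in normal form if $x\cong x'\Rightarrow x=x'$, $y\cong y'\Rightarrow y=y'$, $z\cong z'\Rightarrow z=z'$. Residual information: $RI(U;V)=I(U;V)-H(U\sqcap V)$, where $U\sqcap V$ is a random variable of maximum entropy among those of the form $f(U)=g(V)$ for deterministic $f,g$. Logarithms base 2. *)

(* Defs.v *)
From HB Require Import structures.
From mathcomp Require Import all_boot all_order all_algebra.
From mathcomp Require Import all_classical all_reals all_analysis.
Set Implicit Arguments. Unset Strict Implicit. Unset Printing Implicit Defensive.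
Import Order.TTheory GRing.Theory Num.Theory.
Local Open Scope classical_set_scope.
Local Open Scope ring_scope.

Definition log2 {R : realType} (x : R) : R := ln x / ln 2.

Definition ent {R : realType} (q : R) : R := if q == 0 then 0 else - (q * log2 q).

Section FiniteInfo.
Variables (R : realType) (O : finType) (w : O -> R).
(* w is a probability mass function on the finite sample space O;
   random variables are functions on O. *)

Definition dist (T : eqType) (f : O -> T) (a : T) : R :=
  \sum_(o : O | f o == a) w o.

Definition Hf (T : eqType) (f : O -> T) : R :=
  \sum_(o : O) w o * - log2 (dist f (f o)).

Definition Hcond (T U : eqType) (f : O -> T) (g : O -> U) : R :=
  \sum_(o : O) w o *
    - log2 (dist (fun o' => (f o', g o')) (f o, g o) / dist g (g o)).

Definition MI (T U : eqType) (f : O -> T) (g : O -> U) : R :=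
  \sum_(o : O) w o *
    log2 (dist (fun o' => (f o', g o')) (f o, g o) /
          (dist f (f o) * dist g (g o))).

(* H(f /\ g): the maximum entropy of a random variable of the form
   F(f) = G(g) (almost surely) -- the Gacs-Korner common part. *)
Definition common_ok (T U : eqType) (f : O -> T) (g : O -> U)
    (F : T -> nat) (G : U -> nat) : Prop :=
  forall o, 0 < w o -> F (f o) = G (g o).

Definition Hcommon (T U : eqType) (f : O -> T) (g : O -> U) : R :=
  sup [set Hf (fun o => F (f o)) |
        F in [set F : T -> nat | exists G : U -> nat, common_ok f g F G]].

Definition RI (T U : eqType) (f : O -> T) (g : O -> U) : R :=
  MI f g - Hcommon f g.

End FiniteInfo.

Section NormalForm.
Variables (R : realType) (X Y Z : finType)
  (pXY : X -> Y -> R) (pZ : X -> Y -> Z -> R).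

Definition is_pmf2 : Prop :=
  (forall x y, 0 <= pXY x y) /\ \sum_(x : X) \sum_(y : Y) pXY x y = 1.

Definition is_cond_pmf : Prop :=
  (forall x y z, 0 <= pZ x y z) /\ (forall x y, \sum_(z : Z) pZ x y z = 1).

Definition equivX (x x' : X) : Prop :=
  forall y z, 0 < pXY x y -> 0 < pXY x' y -> pZ x y z = pZ x' y z.

Definition equivY (y y' : Y) : Prop :=
  forall x z, 0 < pXY x y -> 0 < pXY x y' -> pZ x y z = pZ x y' z.

Definition equivZ (z z' : Z) : Prop :=
  exists2 c : R, 0 <= c & forall x y, 0 < pXY x y -> pZ x y z = c * pZ x y z'.

Definition normal_form : Prop :=
  [/\ (forall x x', equivX x x' -> x = x'),
      (forall y y', equivY y y' -> y = y') &
      (forall z z', equivZ z z' -> z = z')].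

Definition wXYZ (o : (X * Y * Z)%type) : R := pXY o.1.1 o.1.2 * pZ o.1.1 o.1.2 o.2.

End NormalForm.

Definition msg := seq bool.
(* The messages exchanged on one link in one round: (forward, backward).
   Link 12: (Alice->Bob, Bob->Alice); link 23: (Bob->Charlie,
   Charlie->Bob); link 31: (Charlie->Alice, Alice->Charlie). *)
Definition rnd := (msg * msg)%type.
Definition lhist := seq rnd.
Definition ghist := seq (rnd * rnd * rnd).

Definition link12 (r : ghist) : lhist := [seq t.1.1 | t <- r].
Definition link23 (r : ghist) : lhist := [seq t.1.2 | t <- r].
Definition link31 (r : ghist) : lhist := [seq t.2 | t <- r].

Definition concat (h : lhist) : msg := flatten [seq u.1 ++ u.2 | u <- h].

Record protocol (R : realType) (X Y Z : Type) := Protocol {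
  (* prefix-free codes, determined by the previous messages on the link *)
  code12f : lhist -> set msg;  (* Alice -> Bob *)
  code12b : lhist -> set msg;  (* Bob -> Alice *)
  code23f : lhist -> set msg;  (* Bob -> Charlie *)
  code23b : lhist -> set msg;  (* Charlie -> Bob *)
  code31f : lhist -> set msg;  (* Charlie -> Alice *)
  code31b : lhist -> set msg;  (* Alice -> Charlie *)
  (* round behaviour (private randomness): conditional probability of the
     messages a party sends in the current round given its view
     (its input and the previous messages on its two links) *)
  alice : X -> lhist (*h12*) -> lhist (*h31*) -> msg (*to Bob*) -> msg (*to Charlie*) -> R;
  bob : Y -> lhist (*h12*) -> lhist (*h23*) -> msg (*to Alice*) -> msg (*to Charlie*) -> R;
  charlie : lhist (*h23*) -> lhist (*h31*) -> msg (*to Bob*) -> msg (*to Alice*) -> R;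
  output : msg (*M23*) -> msg (*M31*) -> Z -> R
}.

Section Protocols.
Variables (R : realType) (X Y Z : finType) (P : protocol R X Y Z).

Definition prefix_free (C : set msg) : Prop :=
  forall u v, C u -> C v -> prefix u v -> u = v.

Definition kernel_ok (k : msg -> msg -> R) (C1 C2 : set msg) : Prop :=
  [/\ (forall a b, 0 <= k a b),
      (forall a b, 0 < k a b -> C1 a /\ C2 b) &
      (\esum_(ab in [set: msg * msg]) (k ab.1 ab.2)%:E = 1)%E].

Definition protocol_ok : Prop :=
  ((forall h, prefix_free (code12f P h) /\ prefix_free (code12b P h)) /\
      (forall h, prefix_free (code23f P h) /\ prefix_free (code23b P h)) /\
      (forall h, prefix_free (code31f P h) /\ prefix_free (code31b P h)) /\
      (forall x h12 h31, kernel_ok (alice P x h12 h31) (code12f P h12) (code31b P h31)) /\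
      (forall y h12 h23, kernel_ok (bob P y h12 h23) (code12b P h12) (code23f P h23)) /\
      (forall h23 h31, kernel_ok (charlie P h23 h31) (code23b P h23) (code31f P h31)) /\
      (forall m23 m31, (forall z, 0 <= output P m23 m31 z) /\
                      \sum_(z : Z) output P m23 m31 z = 1)).

Fixpoint runp_aux (x : X) (y : Y) (acc : ghist) (r : ghist) : R :=
  match r with
  | [::] => 1
  | t :: r' =>
      alice P x (link12 acc) (link31 acc) t.1.1.1 t.2.2 *
      bob P y (link12 acc) (link23 acc) t.1.1.2 t.1.2.1 *
      charlie P (link23 acc) (link31 acc) t.1.2.2 t.2.1 *
      runp_aux x y (rcons acc t) r'
  end.

Definition runp x y (r : ghist) : R := runp_aux x y [::] r.

Definition transcripts (r : ghist) : msg * msg * msg :=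
  (concat (link12 r), concat (link23 r), concat (link31 r)).

Definition stayp x y (m : msg * msg * msg) (N K : nat) : \bar R :=
  \esum_(r in [set r : ghist | size r = (N + K)%N /\
            forall n, (N <= n <= N + K)%N -> transcripts (take n r) = m])
     (runp x y r)%:E.

(* probability that the final transcripts (M12, M23, M31) equal m :
   probability that the transcripts are eventually constant equal to m *)
Definition final_p x y (m : msg * msg * msg) : \bar R :=
  ereal_sup [set ereal_inf [set stayp x y m N K | K in [set: nat]]
            | N in [set: nat]].

Definition jointP (pXY : X -> Y -> R)
    (o : (X * Y * Z) * (msg * msg * msg)) : \bar R :=
  ((pXY o.1.1.1 o.1.1.2)%:E * final_p o.1.1.1 o.1.1.2 o.2 *
    (output P o.2.1.2 o.2.2 o.1.2)%:E)%E.

End Protocols.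

Definition emarg {R : realType} {T : choiceType} {U : Type} (J : T -> \bar R)
    (f : T -> U) (u : U) : \bar R :=
  \esum_(t in [set t | f t = u]) J t.

Definition markov {R : realType} {T : choiceType} {A B C : Type}
    (J : T -> \bar R) (fa : T -> A) (fb : T -> B) (fc : T -> C) : Prop :=
  forall a b c,
    (emarg J (fun t => (fa t, fb t, fc t)) (a, b, c) * emarg J fb b =
     emarg J (fun t => (fa t, fb t)) (a, b) * emarg J (fun t => (fb t, fc t)) (b, c))%E.

Definition Hdisc {R : realType} {T : choiceType} {U : choiceType}
    (J : T -> \bar R) (f : T -> U) : \bar R :=
  \esum_(u in [set: U]) (ent (fine (emarg J f u)))%:E.

Section Secure.
Variables (R : realType) (X Y Z : finType)
  (pXY : X -> Y -> R) (pZ : X -> Y -> Z -> R) (P : protocol R X Y Z).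

Local Notation J := (jointP P pXY).
Definition oX (o : (X * Y * Z) * (msg * msg * msg)) := o.1.1.1.
Definition oY (o : (X * Y * Z) * (msg * msg * msg)) := o.1.1.2.
Definition oZ (o : (X * Y * Z) * (msg * msg * msg)) := o.1.2.
Definition oM12 (o : (X * Y * Z) * (msg * msg * msg)) := o.2.1.1.
Definition oM23 (o : (X * Y * Z) * (msg * msg * msg)) := o.2.1.2.
Definition oM31 (o : (X * Y * Z) * (msg * msg * msg)) := o.2.2.

Definition secure : Prop :=
  (protocol_ok P /\
      (* termination with probability 1 *)
      (forall x y, 0 < pXY x y ->
        (\esum_(m in [set: msg * msg * msg]) final_p P x y m = 1)%E) /\
      (forall x y z, 0 < pXY x y ->
        (\esum_(m in [set: msg * msg * msg])
            (final_p P x y m * (output P m.1.2 m.2 z)%:E) = (pZ x y z)%:E)%E) /\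
      (* privacy against Alice, Bob, Charlie *)
      markov J (fun o => (oM12 o, oM31 o)) oX (fun o => (oY o, oZ o)) /\
      markov J (fun o => (oM12 o, oM23 o)) oY (fun o => (oX o, oZ o)) /\
      markov J (fun o => (oM23 o, oM31 o)) oZ (fun o => (oX o, oY o))).

End Secure.

(* Main.v *)
Require Import Defs.
From HB Require Import structures.
From mathcomp Require Import all_boot all_order all_algebra.
From mathcomp Require Import all_classical all_reals all_analysis.
From mathcomp Require Import ring lra.
Set Implicit Arguments. Unset Strict Implicit. Unset Printing Implicit Defensive.
Import Order.TTheory GRing.Theory Num.Theory.
Import numFieldNormedType.Exports.
Local Open Scope classical_set_scope.
Local Open Scope ring_scope.

(* Because the messages on each link come from prefix-free codes, a transcript and a number of
   rounds determine the link history, so the law of the final transcripts factors as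
   alpha(x, m12, m31) * beta(y, m12, m23) * gamma(m23, m31). Combined with privacy and the normal
   form, this makes each party's variable a function of the transcripts on its two links.

   Write u, v, t for the variables of three parties, a, b, c for the links u-v, v-t, t-u. By
   privacy, p(a | u) = p(a | v) on the support, so q := (the law of a given u) is a common function
   of u and v, and I(u;v) - H(q) >= RI(u;v). The bound on H(b) then follows from
     H(b) >= H(v | q) + H(t | u, v) = I(u;v) - H(q) + H(v, t | u).
   H(a) and H(c) may be infinite, so this is not proved by the chain rule for entropies but by a
   single Gibbs inequality: with g = p(q) p(u,v) / (p(v) p(u,v,t)), the right-hand side is
   E[log g], and E[g p(b)] <= 1. *)

(** * The law of the final transcripts factors over the parties *)

Section Link.
Variables cf cb : lhist -> set msg.

(** [acc] holds the rounds already read, on which the codes of the next round depend. *)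
Fixpoint valid_from (acc h : lhist) : Prop :=
  match h with
  | [::] => True
  | u :: h' => [/\ cf acc u.1, cb acc u.2 & valid_from (rcons acc u) h']
  end.

Lemma valid_from_take n acc h : valid_from acc h -> valid_from acc (take n h).
Proof.
elim: h acc n => [//|u h IH] acc [//|n] /= [? ? ?]; split => //; exact: IH.
Qed.

(** Two prefixes of one string are comparable, so prefix-freeness identifies the leading
    codewords. *)
Lemma prefix_free_cat (C : set msg) (a b s t : msg) : prefix_free C ->
  C a -> C b -> a ++ s = b ++ t -> a = b /\ s = t.
Proof.
move=> Cpf Ca Cb e.
have ab : a = b.
  have /orP[ab|ab] : prefix a b || prefix b a.
  - rewrite !prefixE; case: (leqP (size a) (size b)) => ab.
      by rewrite -(takel_cat t ab) -e take_size_cat// eqxx.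
    by rewrite -(takel_cat s (ltnW ab)) e take_size_cat// eqxx orbT.
  - exact: Cpf.
  - by apply/esym/Cpf.
by split=> //; move: e; rewrite ab => /eqP; rewrite eqseq_cat// eqxx => /eqP.
Qed.

Hypothesis pf : forall h, prefix_free (cf h) /\ prefix_free (cb h).

(** Decoding proceeds codeword by codeword. The number of rounds is fixed because a prefix-free code
    may consist of the empty word, and such silent rounds leave no trace in the transcript. *)
Lemma valid_from_inj acc h h' : valid_from acc h -> valid_from acc h' ->
  size h = size h' -> concat h = concat h' -> h = h'.
Proof.
elim: h acc h' => [|u h IH] acc [|u' h']//= [c1 c2 vh] [c1' c2' vh'] [sz].
rewrite /concat /= -!catA => e; have [e1 e'] := prefix_free_cat (pf acc).1 c1 c1' e.
have [e2 e''] := prefix_free_cat (pf acc).2 c2 c2' e'.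
have uu : u = u' by move: e1 e2; case: (u) (u') => [? ?] [? ?] /= -> ->.
by rewrite uu; congr cons; apply: (IH (rcons acc u)) => //; rewrite uu.
Qed.

(** The single-link counterpart of the event in [stayp], restricted to the histories that the codes
    allow. *)
Definition staying (m : msg) (N K : nat) : set lhist :=
  [set h | [/\ valid_from [::] h, size h = (N + K)%N &
     forall n, (N <= n <= N + K)%N -> concat (take n h) = m]].

(** At [n = N + K] the whole history has transcript [m], which together with the number of rounds
    determines a valid history. *)
Lemma staying_unique m N K N' K' h h' : (N + K = N' + K')%N ->
  staying m N K h -> staying m N' K' h' -> h = h'.
Proof.
move=> NK [vh sh ch] [vh' sh' ch']; apply: (valid_from_inj vh vh').
  by rewrite sh sh'.
have := ch _ (introT andP (conj (leq_addr K N) (leqnn _))).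
have := ch' _ (introT andP (conj (leq_addr K' N') (leqnn _))).
by rewrite -{1}sh' -sh !take_size => -> ->.
Qed.

Lemma xget_staying m N K h :
  staying m N K h -> xget [::] (staying m N K) = h.
Proof. by move=> sh; apply: xget_subset1 => // ? ?; exact: staying_unique. Qed.

Lemma staying_take m N K h :
  staying m N K.+1 h -> staying m N K (take (N + K) h).
Proof.
move=> [vh sh ch]; split; first exact: valid_from_take.
  by rewrite size_takel// sh addnS.
move=> n /andP[Nn nNK]; rewrite take_takel//; apply: ch.
by rewrite Nn addnS leqW.
Qed.

Lemma staying_shift m N K : staying m N K.+1 `<=` staying m N.+1 K.
Proof.
move=> h [vh sh ch]; split=> //; first by rewrite sh addnS.
by move=> n /andP[Nn nNK]; apply: ch; rewrite ltnW//= addnS.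
Qed.

End Link.

(** * The share of one party in the probability of a run *)

Section Party.
Variables (R : realType) (k : lhist -> lhist -> rnd -> rnd -> R).

Fixpoint party_prob (acc1 acc2 h1 h2 : lhist) : R :=
  match h1, h2 with
  | u1 :: h1', u2 :: h2' =>
      k acc1 acc2 u1 u2 * party_prob (rcons acc1 u1) (rcons acc2 u2) h1' h2'
  | _, _ => 1
  end.

Hypothesis k01 : forall a1 a2 u1 u2, 0 <= k a1 a2 u1 u2 <= 1.

Lemma party_prob01 a1 a2 h1 h2 : 0 <= party_prob a1 a2 h1 h2 <= 1.
Proof.
elim: h1 a1 a2 h2 => [|u1 h1 IH] a1 a2 [|u2 h2] /=; rewrite ?ler01 ?lexx//.
have /andP[? ?] := k01 a1 a2 u1 u2.
have /andP[? ?] := IH (rcons a1 u1) (rcons a2 u2) h2.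
by rewrite mulr_ge0//= mulr_ile1.
Qed.

Lemma party_prob_take n a1 a2 h1 h2 :
  party_prob a1 a2 h1 h2 <= party_prob a1 a2 (take n h1) (take n h2).
Proof.
elim: h1 a1 a2 n h2 => [|u1 h1 IH] a1 a2 [|n] [|u2 h2]//=.
  by have /andP[] := party_prob01 a1 a2 (u1 :: h1) (u2 :: h2).
have /andP[? ?] := k01 a1 a2 u1 u2.
exact: ler_wpM2l.
Qed.

(** It is applied to [staying] sets, which have at most one element, so [xget] returns the only
    history. The value 0 covers transcripts without a valid history. *)
Definition party_weight (S1 S2 : set lhist) : R :=
  if `[< S1 !=set0 /\ S2 !=set0 >] then
    party_prob [::] [::] (xget [::] S1) (xget [::] S2)
  else 0.

Lemma party_weight01 S1 S2 : 0 <= party_weight S1 S2 <= 1.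
Proof. by rewrite /party_weight; case: ifP => _; rewrite ?party_prob01// lexx ler01. Qed.

(* [stayp] satisfies the last two conditions; they turn the infimum over [K] and then the
   supremum over [N] into limits, which commute with products. *)
Definition steady (f : nat -> nat -> R) : Prop :=
  [/\ forall N K, 0 <= f N K <= 1,
      forall N K, f N K.+1 <= f N K &
      forall N K, f N K.+1 <= f N.+1 K].

(** One more round multiplies the weight by a factor of at most 1, hence the decrease in [K]. Moving
    a round from [K] to [N] keeps the history and weakens the condition on it, hence the comparison
    of [N] with [N.+1]. *)
Lemma steady_party_weight cf1 cb1 cf2 cb2 m1 m2 :
  (forall h, prefix_free (cf1 h) /\ prefix_free (cb1 h)) ->
  (forall h, prefix_free (cf2 h) /\ prefix_free (cb2 h)) ->
  steady (fun N K => party_weight (staying cf1 cb1 m1 N K) (staying cf2 cb2 m2 N K)).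
Proof.
move=> pf1 pf2; split=> N K; first exact: party_weight01.
- rewrite {1}/party_weight; case: asboolP => [[[h1 s1] [h2 s2]]|_]; last first.
    by have /andP[] := party_weight01 (staying cf1 cb1 m1 N K) (staying cf2 cb2 m2 N K).
  have t1 := staying_take s1; have t2 := staying_take s2.
  rewrite /party_weight asboolT; last by split; [exists (take (N + K) h1)|exists (take (N + K) h2)].
  rewrite (xget_staying pf1 s1) (xget_staying pf2 s2).
  rewrite (xget_staying pf1 t1) (xget_staying pf2 t2).
  exact: party_prob_take.
- rewrite {1}/party_weight; case: asboolP => [[[h1 s1] [h2 s2]]|_]; last first.
    by have /andP[] := party_weight01 (staying cf1 cb1 m1 N.+1 K) (staying cf2 cb2 m2 N.+1 K).
  have t1 := staying_shift s1; have t2 := staying_shift s2.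
  rewrite /party_weight asboolT; last by split; [exists h1|exists h2].
  rewrite (xget_staying pf1 s1) (xget_staying pf2 s2).
  by rewrite (xget_staying pf1 t1) (xget_staying pf2 t2).
Qed.

End Party.

(** * Iterated limits of steady double sequences *)

Section SupInf.
Variable R : realType.
Implicit Types f g : nat -> nat -> R.

Definition iter_lim f : R := limn (fun N => limn (f N)).

Lemma steady_in f N : steady f -> cvgn (f N).
Proof.
move=> [f01 dec _]; apply: nonincreasing_is_cvgn.
  by apply/nonincreasing_seqP => K; exact: dec.
by exists 0 => _ [K _ <-]; have /andP[] := f01 N K.
Qed.

Lemma steady_lim01 f : steady f -> forall N, 0 <= limn (f N) <= 1.
Proof.
move=> sf N; have [f01 dec _] := sf; have cf : cvgn (f N) by exact: steady_in.
apply/andP; split.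
  by apply: limr_ge => //; apply: nearW => K; have /andP[] := f01 N K.
by apply: limr_le => //; apply: nearW => K; have /andP[] := f01 N K.
Qed.

(** For each [K] the limit of [f N] is at most [f N K.+1], hence at most [f N.+1 K]. *)
Lemma steady_lim_mono f : steady f -> {homo (fun N => limn (f N)) : n m / (n <= m)%N >-> n <= m}.
Proof.
move=> sf; have [f01 dec sh] := sf.
apply/nondecreasing_seqP => N.
have c1 : cvgn (f N) by exact: steady_in.
have c2 : cvgn (f N.+1) by exact: steady_in.
apply: limr_ge => //; apply: nearW => K.
apply: le_trans (sh N K).
by apply: nonincreasing_cvgn_ge => //; apply/nonincreasing_seqP => n; exact: dec.
Qed.

Lemma steady_out f : steady f -> cvgn (fun N => limn (f N)).
Proof.
move=> sf; apply: nondecreasing_is_cvgn; first exact: steady_lim_mono.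
by exists 1 => _ [N _ <-]; have /andP[] := steady_lim01 sf N.
Qed.

Lemma steady_supinf f : steady f ->
  ereal_sup [set ereal_inf [set (f N K)%:E | K in [set: nat]] | N in [set: nat]]
  = (iter_lim f)%:E.
Proof.
move=> sf; have [f01 dec sh] := sf.
have inner N : ereal_inf [set (f N K)%:E | K in [set: nat]] = (limn (f N))%:E.
  have h : {homo (fun K => (f N K)%:E) : n m / (n <= m)%N >-> (m <= n)%E}.
    by move=> n m nm; rewrite lee_fin; have /nonincreasing_seqP := dec N; exact.
  apply: (cvg_unique _ (ereal_nonincreasing_cvgn h)) => //.
  by apply: cvg_EFin; [exact: nearW|exact: steady_in].
under eq_imagel do rewrite inner.
have h : {homo (fun N => (limn (f N))%:E) : n m / (n <= m)%N >-> (n <= m)%E}.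
  by move=> n m nm; rewrite lee_fin; exact: steady_lim_mono.
apply: (cvg_unique _ (ereal_nondecreasing_cvgn h)) => //.
by apply: cvg_EFin; [exact: nearW|exact: steady_out].
Qed.

Lemma steadyM f g : steady f -> steady g -> steady (fun N K => f N K * g N K).
Proof.
move=> [f01 fd fs] [g01 gd gs].
split=> N K; have /andP[? ?] := f01 N K; have /andP[? ?] := g01 N K.
- by rewrite mulr_ge0//= mulr_ile1.
- by have /andP[? ?] := f01 N K.+1; have /andP[? ?] := g01 N K.+1; exact: ler_pM.
- by have /andP[? ?] := f01 N K.+1; have /andP[? ?] := g01 N K.+1; exact: ler_pM.
Qed.

Lemma iter_limM f g : steady f -> steady g ->
  iter_lim (fun N K => f N K * g N K) = iter_lim f * iter_lim g.
Proof.
move=> sf sg; rewrite /iter_lim -limM; [|exact: steady_out..].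
congr (lim (_ @ \oo)); apply/funext => N /=.
by rewrite -limM//; exact: steady_in.
Qed.

Lemma iter_lim_ge0 f : steady f -> 0 <= iter_lim f.
Proof.
move=> sf; apply: limr_ge; first exact: steady_out.
by apply: nearW => N; have /andP[] := steady_lim01 sf N.
Qed.

End SupInf.

(** * From runs to the law of the final transcripts *)

Section Factorization.
Variables (R : realType) (X Y Z : finType) (P : protocol R X Y Z).

(* [u] and [v] are the current rounds on the party's two links; each step reads the components
   that the party sends. *)
Definition alice_step x (h12 h31 : lhist) (u v : rnd) : R := alice P x h12 h31 u.1 v.2.
Definition bob_step y (h12 h23 : lhist) (u v : rnd) : R := bob P y h12 h23 u.2 v.1.
Definition charlie_step (h23 h31 : lhist) (u v : rnd) : R := charlie P h23 h31 u.2 v.1.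

(** Each kernel reads only the two links of its party, so the product over the rounds splits into
    three. *)
Lemma runp_auxE x y acc r : runp_aux P x y acc r =
  party_prob (alice_step x) (link12 acc) (link31 acc) (link12 r) (link31 r) *
  party_prob (bob_step y) (link12 acc) (link23 acc) (link12 r) (link23 r) *
  party_prob charlie_step (link23 acc) (link31 acc) (link23 r) (link31 r).
Proof.
elim: r acc => [|t r IH] acc /=; first by rewrite !mulr1.
rewrite IH /link12 /link23 /link31 !map_rcons /alice_step /bob_step /charlie_step /=.
set a := alice _ _ _ _ _ _; set b := bob _ _ _ _ _ _; set c := charlie _ _ _ _ _.
set a' := party_prob _ _ _ _ _; set b' := party_prob _ _ _ _ _; set c' := party_prob _ _ _ _ _.
by rewrite mulrACA [a * b * _]mulrACA.
Qed.

Lemma kernel_ok01 (k : msg -> msg -> R) C1 C2 a b : kernel_ok k C1 C2 -> 0 <= k a b <= 1.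
Proof.
move=> [k0 _ k1]; rewrite k0 /= -lee_fin -k1.
apply: esum_ge; exists [set (a, b)]; first by split=> //; exact: finite_set1.
by rewrite fsbig_set1.
Qed.

Lemma kernel_ok_supp (k : msg -> msg -> R) C1 C2 a b :
  kernel_ok k C1 C2 -> k a b != 0 -> C1 a /\ C2 b.
Proof. by move=> [k0 kC _] kn; apply: kC; rewrite lt_def kn k0. Qed.

Hypothesis HP : protocol_ok P.

Lemma pf12 h : prefix_free (code12f P h) /\ prefix_free (code12b P h).
Proof. by case: HP. Qed.
Lemma pf23 h : prefix_free (code23f P h) /\ prefix_free (code23b P h).
Proof. by case: HP => _ []. Qed.
Lemma pf31 h : prefix_free (code31f P h) /\ prefix_free (code31b P h).
Proof. by case: HP => _ [_ []]. Qed.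
Lemma alice_ok x h12 h31 : kernel_ok (alice P x h12 h31) (code12f P h12) (code31b P h31).
Proof. by case: HP => _ [_ [_ []]]. Qed.
Lemma bob_ok y h12 h23 : kernel_ok (bob P y h12 h23) (code12b P h12) (code23f P h23).
Proof. by case: HP => _ [_ [_ [_ []]]]. Qed.
Lemma charlie_ok h23 h31 : kernel_ok (charlie P h23 h31) (code23b P h23) (code31f P h31).
Proof. by case: HP => _ [_ [_ [_ [_ []]]]]. Qed.

Lemma alice_step01 x h12 h31 u v : 0 <= alice_step x h12 h31 u v <= 1.
Proof. exact: kernel_ok01 (alice_ok _ _ _). Qed.
Lemma bob_step01 y h12 h23 u v : 0 <= bob_step y h12 h23 u v <= 1.
Proof. exact: kernel_ok01 (bob_ok _ _ _). Qed.
Lemma charlie_step01 h23 h31 u v : 0 <= charlie_step h23 h31 u v <= 1.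
Proof. exact: kernel_ok01 (charlie_ok _ _). Qed.

Lemma runp_ge0 x y r : 0 <= runp P x y r.
Proof.
rewrite /runp runp_auxE.
have /andP[a0 _] := party_prob01 (alice_step01 x) (link12 [::]) (link31 [::]) (link12 r) (link31 r).
have /andP[b0 _] := party_prob01 (bob_step01 y) (link12 [::]) (link23 [::]) (link12 r) (link23 r).
have /andP[c0 _] := party_prob01 charlie_step01 (link23 [::]) (link31 [::]) (link23 r) (link31 r).
by rewrite !mulr_ge0.
Qed.

Lemma runp_valid x y acc r : runp_aux P x y acc r != 0 ->
  [/\ valid_from (code12f P) (code12b P) (link12 acc) (link12 r),
      valid_from (code23f P) (code23b P) (link23 acc) (link23 r) &
      valid_from (code31f P) (code31b P) (link31 acc) (link31 r)].
Proof.
elim: r acc => [//|t r IH] acc /=; rewrite !mulf_eq0 !negb_or -!andbA.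
move=> /and4P[an bn cn /IH]; rewrite /link12 /link23 /link31 !map_rcons => -[v1 v2 v3].
have [? ?] := kernel_ok_supp (alice_ok _ _ _) an.
have [? ?] := kernel_ok_supp (bob_ok _ _ _) bn.
by have [? ?] := kernel_ok_supp (charlie_ok _ _) cn.
Qed.

Definition stay12 := staying (code12f P) (code12b P).
Definition stay23 := staying (code23f P) (code23b P).
Definition stay31 := staying (code31f P) (code31b P).

Definition wA x m12 m31 N K :=
  party_weight (alice_step x) (stay12 m12 N K) (stay31 m31 N K).
Definition wB y m12 m23 N K :=
  party_weight (bob_step y) (stay12 m12 N K) (stay23 m23 N K).
Definition wC m23 m31 N K :=
  party_weight charlie_step (stay23 m23 N K) (stay31 m31 N K).

Lemma stayp_nz x y m N K r : size r = (N + K)%N ->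
  (forall n, (N <= n <= N + K)%N -> transcripts (take n r) = m) ->
  runp P x y r != 0 ->
  [/\ stay12 m.1.1 N K (link12 r), stay23 m.1.2 N K (link23 r) & stay31 m.2 N K (link31 r)].
Proof.
move=> sr tr /runp_valid[v1 v2 v3].
by split; split=> //; rewrite ?size_map// => n /tr <-; rewrite /= /link12 /link23 /link31 map_take.
Qed.

Definition merge (h12 h23 h31 : lhist) : ghist := zip (zip h12 h23) h31.

Lemma mergeK r : merge (link12 r) (link23 r) (link31 r) = r.
Proof. by elim: r => [//|[[a b] c] r]; rewrite /merge /= => ->. Qed.

Lemma link_merge n h12 h23 h31 : size h12 = n -> size h23 = n -> size h31 = n ->
  [/\ link12 (merge h12 h23 h31) = h12, link23 (merge h12 h23 h31) = h23 &
      link31 (merge h12 h23 h31) = h31].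
Proof.
elim: n h12 h23 h31 => [|n IH] [|a h12] [|b h23] [|c h31]//= [s1] [s2] [s3].
by rewrite /merge /=; have [-> -> ->] := IH _ _ _ s1 s2 s3.
Qed.

(** Given [m] and the number of rounds, each link has at most one history, and three link histories
    merge into one run. The sum thus has at most one nonzero term. *)
Lemma staypE x y m N K : stayp P x y m N K =
  (wA x m.1.1 m.2 N K * wB y m.1.1 m.1.2 N K * wC m.1.2 m.2 N K)%:E.
Proof.
case: (pselect ([/\ stay12 m.1.1 N K !=set0, stay23 m.1.2 N K !=set0 & stay31 m.2 N K !=set0])).
- move=> [[h12 s12] [h23 s23] [h31 s31]].
  rewrite /wA /wB /wC /party_weight !asboolT; try by split; eexists; eassumption.
  rewrite (xget_staying pf12 s12) (xget_staying pf23 s23) (xget_staying pf31 s31).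
  have [v12 z12 c12] := s12; have [v23 z23 c23] := s23; have [v31 z31 c31] := s31.
  have [l12 l23 l31] := link_merge z12 z23 z31.
  set r0 := merge h12 h23 h31 in l12 l23 l31.
  have r0E : runp P x y r0 = party_prob (alice_step x) [::] [::] h12 h31 *
     party_prob (bob_step y) [::] [::] h12 h23 * party_prob charlie_step [::] [::] h23 h31.
    by rewrite /runp runp_auxE l12 l23 l31.
  rewrite -r0E /stayp esum_mkcond.
  (* A run of nonzero probability in the summation set has links [h12], [h23], [h31] by uniqueness,
     so it is [r0]. *)
  rewrite (eq_esum (b := fun r => if r \in [set r0] then (runp P x y r)%:E else 0)%E).
    by rewrite -esum_mkcond esum_set1// lee_fin runp_ge0.
  move=> r _; case: ifPn => [/set_mem[sr tr]|/negP rn].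
    case: ifPn => [//|/negP rr0]; apply/congr1/eqP/negPn/negP => rnz.
    apply: rr0; apply/mem_set => /=; have [q12 q23 q31] := stayp_nz sr tr rnz.
    rewrite -(mergeK r) /r0 (staying_unique pf12 erefl q12 s12).
    by rewrite (staying_unique pf23 erefl q23 s23) (staying_unique pf31 erefl q31 s31).
  case: ifPn => [/set_mem /= rr0|//]; exfalso; apply: rn; apply/mem_set; rewrite /= rr0.
  split; first by rewrite -z12 -l12 /link12 size_map.
  move=> n nK; case: (m) c12 c23 c31 => [[m12 m23] m31] /= c12 c23 c31.
  rewrite /transcripts -(c12 n nK) -(c23 n nK) -(c31 n nK).
  by rewrite -{1}l12 -{1}l23 -{1}l31 /link12 /link23 /link31 !map_take.
- move=> nst; rewrite /stayp esum1; last first.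
    move=> r /= [sr tr]; apply/congr1/eqP/negPn/negP => rnz; apply: nst.
    by have [q12 q23 q31] := stayp_nz sr tr rnz; split; eexists; eassumption.
  rewrite /wA /wB /wC /party_weight.
  do 3 (case: asboolP => [[? ?]|?]; last by rewrite ?mul0r ?mulr0 ?mul0r).
  by exfalso; apply: nst.
Qed.

Lemma steady_wA x m12 m31 : steady (wA x m12 m31).
Proof. by apply: steady_party_weight; [exact: alice_step01|exact: pf12|exact: pf31]. Qed.
Lemma steady_wB y m12 m23 : steady (wB y m12 m23).
Proof. by apply: steady_party_weight; [exact: bob_step01|exact: pf12|exact: pf23]. Qed.
Lemma steady_wC m23 m31 : steady (wC m23 m31).
Proof. by apply: steady_party_weight; [exact: charlie_step01|exact: pf23|exact: pf31]. Qed.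

(** For all [N] and [K], [stayp] is a product of three steady weights, and [iter_lim] is
    multiplicative on steady sequences. *)
Lemma final_p_factor : exists (al : X -> msg -> msg -> R) (be : Y -> msg -> msg -> R)
    (ga : msg -> msg -> R),
  [/\ forall x a b, 0 <= al x a b, forall y a b, 0 <= be y a b, forall a b, 0 <= ga a b &
   forall x y m, final_p P x y m =
     (al x m.1.1 m.2 * be y m.1.1 m.1.2 * ga m.1.2 m.2)%:E].
Proof.
exists (fun x a b => iter_lim (wA x a b)), (fun y a b => iter_lim (wB y a b)),
  (fun a b => iter_lim (wC a b)); split.
- by move=> *; apply/iter_lim_ge0/steady_wA.
- by move=> *; apply/iter_lim_ge0/steady_wB.
- by move=> *; apply/iter_lim_ge0/steady_wC.
move=> x y m.
have sA := steady_wA x m.1.1 m.2; have sB := steady_wB y m.1.1 m.1.2.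
have sC := steady_wC m.1.2 m.2; have sAB := steadyM sA sB.
rewrite -iter_limM// -iter_limM// -steady_supinf; last exact: steadyM.
rewrite /final_p; congr (ereal_sup _); apply: eq_imagel => N _.
by congr (ereal_inf _); apply: eq_imagel => K _; rewrite staypE.
Qed.

End Factorization.

(** * Entropy of a link transcript *)

Section Esum.
Variable R : realType.
Local Open Scope ereal_scope.

(** One inequality comes from finite subsums; the other is the same inequality for [c^-1]. *)
Lemma esumZ (I : choiceType) (S : set I) (c : R) (a : I -> \bar R) :
  (0 <= c)%R -> (forall i, 0 <= a i) ->
  \esum_(i in S) (c%:E * a i) = c%:E * \esum_(i in S) a i.
Proof.
move=> c0 a0.
have le d (b : I -> \bar R) : (0 <= d)%R -> (forall i, 0 <= b i) ->
    \esum_(i in S) (d%:E * b i) <= d%:E * \esum_(i in S) b i.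
  move=> d0 b0; apply: ge_ereal_sup => /= _ [F [finF FS] <-].
  rewrite -ge0_mule_fsumr//; apply: lee_wpmul2l; first by rewrite lee_fin.
  by apply: ereal_sup_ubound; exists F.
apply/eqP; rewrite eq_le le//=.
have [->|cn0] := eqVneq c 0%R.
  by rewrite mul0e esum1// => i _; rewrite mul0e.
have {cn0}c0 : (0 < c)%R by rewrite lt_def cn0.
rewrite [X in c%:E * X](_ : _ = \esum_(i in S) (c^-1%:E * (c%:E * a i))); last first.
  by apply: eq_esum => i _; rewrite muleA -EFinM mulVf ?gt_eqF// mul1e.
apply: (le_trans (lee_wpmul2l _ (le _ _ _ _))).
- by rewrite lee_fin ltW.
- by rewrite invr_ge0 ltW.
- by move=> i; rewrite mule_ge0// lee_fin ltW.
- by rewrite muleA -EFinM mulfV ?gt_eqF// mul1e.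
Qed.

Lemma esum_fibers (I K : choiceType) (S : set I) (Q : set K) (f : I -> K)
    (a : I -> \bar R) : (forall i, 0 <= a i) -> (forall i, S i -> Q (f i)) ->
  \esum_(i in S) a i = \esum_(y in Q) \esum_(i in [set i | S i /\ f i = y]) a i.
Proof.
move=> a0 SQ; rewrite esum_esum//.
rewrite (reindex_esum S _ (fun i => (f i, i)))//; split.
- by move=> i Si /=; split=> //; exact: SQ.
- by move=> i i' _ _ [].
- by move=> [y i] /= [_ [Si <-]]; exists i.
Qed.

Lemma esum_finType (I : finType) (p : pred I) (a : I -> \bar R) :
  (forall i, 0 <= a i) -> \esum_(i in [set i | p i]) a i = \sum_(i | p i) a i.
Proof.
move=> a0; have fT : finite_set [set: I] by exact: finite_finset.
rewrite esum_mkcond esum_fset//; last by move=> i _; case: ifP.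
rewrite fsbig_finite// [RHS]big_mkcond /= (perm_big (index_enum I)) /=; last first.
  apply: uniq_perm => [||i]; rewrite ?finmap.fset_uniq ?index_enum_uniq//.
  by rewrite in_fset_set// mem_index_enum in_setT.
apply: eq_bigr => i _.
by case: ifPn => [/set_mem /= ->//|/negP ni]; case: ifPn => // pi; exfalso; apply/ni/mem_set.
Qed.

End Esum.

(** * Marginals of a nonnegative weight *)

Section Marginals.
Variables (R : realType) (T : choiceType) (J : T -> \bar R).
Hypothesis J0 : forall t, (0 <= J t)%E.
Local Open Scope ereal_scope.

Lemma emarg_ge0 (U : Type) (f : T -> U) y : 0 <= emarg J f y.
Proof. exact: esum_ge0. Qed.

Lemma emarg_eq (U U' : Type) (f : T -> U) (f' : T -> U') y y' :
  (forall t, f t = y <-> f' t = y') -> emarg J f y = emarg J f' y'.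
Proof.
by move=> e; congr (esum _ _); apply/seteqP; split=> t /=; rewrite e.
Qed.

Lemma emarg_comp (U : choiceType) (U' : Type) (f : T -> U) (phi : U -> U') y :
  emarg J (fun t => phi (f t)) y = \esum_(x in [set x | phi x = y]) emarg J f x.
Proof.
rewrite /emarg (esum_fibers (f := f) (Q := [set x | phi x = y]))//.
apply: eq_esum => x /= <-; congr (esum _ _); apply/seteqP.
by split=> t /= => [[]//|->].
Qed.

Lemma esum_emarg (U : choiceType) (f : T -> U) (h : U -> R) :
  (forall x, 0 <= h x)%R ->
  \esum_(t in [set: T]) (h (f t))%:E * J t = \esum_(x in [set: U]) (h x)%:E * emarg J f x.
Proof.
move=> h0; rewrite (esum_fibers (f := f) (Q := setT))//; last first.
  by move=> t; rewrite mule_ge0// lee_fin.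
apply: eq_esum => x _; rewrite -esumZ//.
rewrite [X in esum X _](_ : _ = [set t | f t = x]); last first.
  by apply/seteqP; split=> t /= [].
by apply: eq_esum => t /= ->.
Qed.

Lemma emarg_gt0 (U : Type) (f : T -> U) t : 0 < J t -> 0 < emarg J f (f t).
Proof.
move=> Jt; apply: (lt_le_trans Jt); apply: esum_ge.
by exists [set t]; [split; [exact: finite_set1|move=> ? ->]|rewrite fsbig_set1].
Qed.

(* At most one value x of g is compatible with each value y of f, so the sum over x
   on the left has a single term. *)
Lemma esum_determined_le (A : choiceType) (V : Type) (f : T -> A) (g : T -> V)
    (rel : A -> V -> Prop) (k : A -> V -> R) (l : A -> R) :
  (forall y x, 0 <= k y x)%R -> (forall y, 0 <= l y)%R ->
  (forall y x x', rel y x -> rel y x' -> x = x') ->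
  (forall y x, rel y x ->
     (k y x)%:E * emarg J (fun t => (f t, g t)) (y, x) <= (l y)%:E * emarg J f y) ->
  \esum_(t in [set t | rel (f t) (g t)]) (k (f t) (g t))%:E * J t
    <= \esum_(t in [set: T]) (l (f t))%:E * J t.
Proof.
move=> k0 l0 uniq kl.
rewrite esum_emarg// (esum_fibers (f := f) (Q := setT))//; last first.
  by move=> t; rewrite mule_ge0// lee_fin.
apply: le_esum => y _; have [[x yx]|nex] := pselect (exists x, rel y x).
  apply: le_trans (kl _ _ yx); rewrite -esumZ//.
  rewrite [X in esum X _](_ : _ = [set t | (f t, g t) = (y, x)]); last first.
    apply/seteqP; split=> t /=; last by case=> -> ->.
    by move=> [r e]; rewrite e in r *; rewrite (uniq _ _ _ r yx).
  by rewrite le_eqVlt (eq_esum (b := fun t => (k y x)%:E * J t)) ?eqxx// => t /= [-> ->].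
rewrite esum1; first by rewrite mule_ge0 ?lee_fin// emarg_ge0.
by move=> t /= [r e]; exfalso; apply: nex; exists (g t); rewrite -e.
Qed.

End Marginals.

(** * Symmetry and coarsening of Markov chains *)

Section Markov.
Variables (R : realType) (T : choiceType) (J : T -> \bar R).
Hypothesis J0 : forall t, (0 <= J t)%E.
Hypothesis Jfin : forall (U : Type) (f : T -> U) y, emarg J f y \is a fin_num.
Local Open Scope ereal_scope.

Lemma markov_sym (A B C : Type) (fa : T -> A) (fb : T -> B) (fc : T -> C) :
  Defs.markov J fa fb fc -> Defs.markov J fc fb fa.
Proof.
move=> m c b a; rewrite (emarg_eq J (f' := fun t => (fa t, fb t, fc t)) (y' := (a, b, c))).
  rewrite m muleC; congr (_ * _); apply: emarg_eq => t; by split=> -[-> ->].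
by move=> t; split=> -[-> -> ->].
Qed.

(** Both sides are linear in the law of [fa], so the identities over a fiber of [phi] add up; the
    two remaining factors are finite and pass under the sums. *)
Lemma markov_comp (A : choiceType) (A' B C : Type) (phi : A -> A') (fa : T -> A) (fb : T -> B)
    (fc : T -> C) : Defs.markov J fa fb fc -> Defs.markov J (fun t => phi (fa t)) fb fc.
Proof.
move=> m a b c.
have pull (D : Type) (fd : T -> D) d : emarg J (fun t => (phi (fa t), fd t)) (a, d) =
    \esum_(x in [set x | phi x = a]) emarg J (fun t => (fa t, fd t)) (x, d).
  rewrite /emarg (esum_fibers (f := fa) (Q := [set x | phi x = a]))//; last by move=> t [].
  apply: eq_esum => x /= <-; congr (esum _ _); apply/seteqP.
  by split=> t /= => [[[_ ->] ->]//|[-> ->]].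
rewrite (emarg_eq J (f' := fun t => (phi (fa t), (fb t, fc t))) (y' := (a, (b, c)))); last first.
  by move=> t; split=> -[-> -> ->].
rewrite !pull -(fineK (Jfin fb b)) -(fineK (Jfin (fun t => (fb t, fc t)) (b, c))).
rewrite [LHS]muleC [RHS]muleC -!esumZ ?fine_ge0 ?emarg_ge0//; do ?by move=> ?; exact: emarg_ge0.
apply: eq_esum => x _; rewrite !fineK// [LHS]muleC [RHS]muleC -m; congr (_ * _).
by apply: emarg_eq => t; split=> -[-> -> ->].
Qed.

End Markov.

Section Log2.
Variable R : realType.
Implicit Types x y : R.

Lemma ln2_gt0 : 0 < ln 2 :> R.
Proof. by rewrite ln_gt0// ltr1n. Qed.

Lemma log2M x y : 0 < x -> 0 < y -> log2 (x * y) = log2 x + log2 y.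
Proof. by move=> x0 y0; rewrite /log2 lnM ?posrE// mulrDl. Qed.

Lemma log2V x : 0 < x -> log2 x^-1 = - log2 x.
Proof. by move=> x0; rewrite /log2 lnV ?posrE// mulNr. Qed.

Lemma log2_ge0 x : 1 <= x -> 0 <= log2 x.
Proof. by move=> x1; rewrite /log2 divr_ge0 ?ln_ge0 ?ler1n. Qed.

Lemma log2_le0 x : x <= 1 -> log2 x <= 0.
Proof. by move=> x1; rewrite /log2 mulr_le0_ge0 ?ln_le0// invr_ge0 ltW// ln2_gt0. Qed.

Lemma log2_le x y : 0 < x -> x <= y -> log2 x <= log2 y.
Proof.
move=> x0 xy; rewrite /log2 ler_pM2r ?invr_gt0 ?ln2_gt0//.
by rewrite ler_ln ?posrE// (lt_le_trans x0).
Qed.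

Lemma log2_sub1 x : 0 < x -> log2 x <= (x - 1) / ln 2.
Proof.
move=> x0; rewrite /log2 ler_pM2r ?invr_gt0 ?ln2_gt0//.
by have := @le_ln1Dx R (x - 1); rewrite (addrC 1) subrK; apply; rewrite ltrBDr addNr.
Qed.

End Log2.

(** * Entropy and common information on the finite sample space *)

Section Dist.
Variables (R : realType) (O : finType) (w : O -> R).
Hypothesis w0 : forall o, 0 <= w o.

Lemma dist_ge0 (U : eqType) (f : O -> U) y : 0 <= dist w f y.
Proof. exact: sumr_ge0. Qed.

Lemma dist_le (U U' : eqType) (f : O -> U) (f' : O -> U') y y' :
  (forall o, 0 < w o -> f o = y -> f' o = y') -> dist w f y <= dist w f' y'.
Proof.
move=> h; rewrite /dist big_mkcond [leRHS]big_mkcond; apply: ler_sum => o _.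
have [->|wn] := eqVneq (w o) 0; first by do 2 case: ifP.
have wp : 0 < w o by rewrite lt_def wn w0.
by case: ifPn => [/eqP/(h _ wp) ->|_]; rewrite ?eqxx//; case: ifP.
Qed.

Lemma dist_eq (U U' : eqType) (f : O -> U) (f' : O -> U') y y' :
  (forall o, 0 < w o -> f o = y <-> f' o = y') -> dist w f y = dist w f' y'.
Proof.
by move=> h; apply/eqP; rewrite eq_le !dist_le// => o /h ->.
Qed.

Lemma dist_ge (U : eqType) (f : O -> U) o : w o <= dist w f (f o).
Proof. by rewrite /dist (bigD1 o)//= lerDl sumr_ge0. Qed.

Lemma dist_gt0 (U : eqType) (f : O -> U) o : 0 < w o -> 0 < dist w f (f o).
Proof. by move=> wo; apply: lt_le_trans wo (dist_ge _ _). Qed.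

Lemma Hcommon_ge (U V : eqType) (u : O -> U) (v : O -> V) F G :
  common_ok w u v F G -> Hf w (fun o => F (u o)) <= Hcommon w u v.
Proof.
move=> FG; apply: ub_le_sup; last by exists F => //; exists G.
(* The entropy of the whole outcome bounds every entropy in the set, since each [dist] is at least
   [w o]. *)
exists (\sum_o w o * - log2 (w o)) => _ [F' _ <-]; apply: ler_sum => o _.
have [->|wn] := eqVneq (w o) 0; first by rewrite !mul0r.
have wp : 0 < w o by rewrite lt_def wn w0.
rewrite ler_pM2l// lerN2 log2_le//; exact: (dist_ge (fun o => F' (u o))).
Qed.

(** A common variable has two names, [F (u o)] and [G (v o)], which agree on the support; hence both
    suprema run over the same entropies. *)
Lemma RI_sym (U V : eqType) (u : O -> U) (v : O -> V) : RI w u v = RI w v u.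
Proof.
rewrite /RI; congr (_ - _).
  apply: eq_bigr => o _; congr (_ * log2 (_ / _)); last exact: mulrC.
  by apply: dist_eq => o' _; split=> -[-> ->].
rewrite /Hcommon; congr (sup _).
have half (U1 V1 : eqType) (f : O -> U1) (g : O -> V1) :
    [set Hf w (fun o => F (f o)) | F in [set F | exists G, common_ok w f g F G]] `<=`
    [set Hf w (fun o => F (g o)) | F in [set F | exists G, common_ok w g f F G]].
  move=> _ [F [G FG] <-]; exists G; first by exists F => o /FG.
  apply: eq_bigr => o _; have [->|wn] := eqVneq (w o) 0; first by rewrite !mul0r.
  have wp : 0 < w o by rewrite lt_def wn w0.
  by congr (_ * - log2 _); apply: dist_eq => o' wo'; rewrite -(FG _ wo') -(FG _ wp).
by apply/seteqP; split; exact: half.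
Qed.

(** The inequality is only that H(F(u)) is at most the common entropy. After it the logarithms are
    collected outcome by outcome, and p(u) cancels between the mutual information and the
    conditional entropy. *)
Lemma RI_Hcond_le (U V W : eqType) (u : O -> U) (v : O -> V) (t : O -> W) F G :
  common_ok w u v F G ->
  RI w u v + Hcond w (fun o => (v o, t o)) u <=
  \sum_o w o * log2 (dist w (fun o => F (u o)) (G (v o)) *
                     dist w (fun o => (u o, v o)) (u o, v o) /
       (dist w v (v o) * dist w (fun o => ((v o, t o), u o)) ((v o, t o), u o))).
Proof.
move=> FG; rewrite /RI -addrA -lerBrDl.
have FGle := Hcommon_ge FG.
apply: (@le_trans _ _ (- Hf w (fun o => F (u o)) + Hcond w (fun o => (v o, t o)) u)).
  by rewrite lerD2r lerN2.
rewrite lerBrDl addrA /MI /Hf /Hcond -sumrB -big_split /=.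
apply: ler_sum => o _; have [->|wn] := eqVneq (w o) 0; first by rewrite !mul0r subrr addr0.
have wp : 0 < w o by rewrite lt_def wn w0.
rewrite -mulrBr -mulrDr ler_pM2l// -(FG _ wp).
have q0 := dist_gt0 (fun o => F (u o)) wp; have u0 := dist_gt0 u wp; have v0 := dist_gt0 v wp.
have uv0 := dist_gt0 (fun o => (u o, v o)) wp.
have vtu0 := dist_gt0 (fun o => ((v o, t o), u o)) wp.
rewrite !log2M ?log2V ?invr_gt0 ?mulr_gt0// !log2M//.
by rewrite le_eqVlt; apply/orP; left; apply/eqP; ring.
Qed.

End Dist.

(** * A probability on an arbitrary type over a finite sample space, and Gibbs' inequality *)

Section Density.
Variables (R : realType) (T : choiceType) (j : T -> R).
Let J (t : T) : \bar R := (j t)%:E.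
Hypothesis j0 : forall t, 0 <= j t.
Variables (O : finType) (w : O -> R) (s : T -> O).
Hypothesis Jw : forall o, emarg J s o = (w o)%:E.
Hypothesis w1 : \sum_o w o = 1.

Lemma J_ge0 t : (0 <= J t)%E. Proof. by rewrite lee_fin. Qed.

Lemma w_ge0 o : 0 <= w o.
Proof. by rewrite -lee_fin -Jw; apply: emarg_ge0 => t; exact: J_ge0. Qed.

Lemma emarg_dist (U : eqType) (g : O -> U) y :
  emarg J (fun t => g (s t)) y = (dist w g y)%:E.
Proof.
rewrite (emarg_comp J_ge0 s g) (eq_esum (b := fun o => (w o)%:E))//.
rewrite [X in esum X _](_ : _ = [set o | g o == y]).
  by rewrite esum_finType ?sumEFin// => o; rewrite lee_fin w_ge0.
by apply/seteqP; split=> o /eqP.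
Qed.

Lemma total_mass : \esum_(t in [set: T]) J t = 1%E.
Proof.
have := emarg_dist (fun=> tt) tt; rewrite /emarg /dist => e.
rewrite [X in esum X _](_ : _ = [set t | tt = tt]); last by apply/seteqP; split.
by rewrite e (eq_bigl xpredT) ?w1// => o; rewrite eqxx.
Qed.

Lemma emarg_le1 (U : Type) (f : T -> U) y : (emarg J f y <= 1)%E.
Proof.
rewrite -total_mass /emarg [leLHS]esum_mkcond; apply: le_esum => t _.
by case: ifP => // _; exact: J_ge0.
Qed.

Lemma emarg_fin (U : Type) (f : T -> U) y : emarg J f y \is a fin_num.
Proof.
rewrite ge0_fin_numE ?(le_lt_trans (emarg_le1 f y)) ?ltry//.
by apply: emarg_ge0; exact: J_ge0.
Qed.

Definition pr (U : Type) (f : T -> U) y : R := fine (emarg J f y).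

Lemma emargE (U : Type) (f : T -> U) y : emarg J f y = (pr f y)%:E.
Proof. by rewrite fineK// emarg_fin. Qed.

Lemma pr_ge0 (U : Type) (f : T -> U) y : 0 <= pr f y.
Proof. by apply/fine_ge0/emarg_ge0; exact: J_ge0. Qed.

Lemma pr_le1 (U : Type) (f : T -> U) y : pr f y <= 1.
Proof. by rewrite -lee_fin -emargE emarg_le1. Qed.

Lemma pr_gt0 (U : Type) (f : T -> U) t : 0 < j t -> 0 < pr f (f t).
Proof. by move=> jt; rewrite -lte_fin -emargE emarg_gt0// lte_fin. Qed.

Lemma pr_dist (U : eqType) (g : O -> U) y : pr (fun t => g (s t)) y = dist w g y.
Proof. by rewrite /pr emarg_dist. Qed.

Lemma w_gt0 t : 0 < j t -> 0 < w (s t).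
Proof. by move=> jt; rewrite -lte_fin -Jw emarg_gt0// lte_fin. Qed.

(* Gibbs' inequality [log x <= x - 1] at [x = g (s t) * pr b (b t)]. *)
Lemma Hdisc_ge (A : choiceType) (b : T -> A) (g : O -> R) :
  (forall o, 1 <= g o) ->
  (forall y, \esum_(t in [set t | b t = y]) ((g (s t))%:E * J t) <= 1)%E ->
  ((\sum_o w o * log2 (g o))%:E <= Hdisc J b)%E.
Proof.
move=> g1 gb; pose L : R := (ln 2)^-1; have L0 : 0 < L by rewrite invr_gt0 ln2_gt0.
have g0 o : 0 <= g o by apply: le_trans (g1 o).
have J0 := J_ge0.
pose h y : R := - log2 (pr b y).
have h0 y : 0 <= h y by rewrite oppr_ge0 log2_le0// pr_le1.
have -> : Hdisc J b = \esum_(t in [set: T]) ((h (b t))%:E * J t)%E.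
  rewrite (esum_emarg J0)//; apply: eq_esum => y _; rewrite emargE -EFinM /=.
  by rewrite /ent /h; case: eqP => [->|_]; rewrite ?mulr0// mulNr mulrC.
have -> : (\sum_o w o * log2 (g o))%:E = \esum_(t in [set: T]) ((log2 (g (s t)))%:E * J t)%E.
  rewrite (esum_emarg J0 s (h := fun o => log2 (g o))) => [|o]; last exact: log2_ge0.
  rewrite (_ : [set: O] = [set o | xpredT o]); last by apply/seteqP; split.
  rewrite esum_finType; last by move=> o; rewrite mule_ge0 ?lee_fin ?log2_ge0// emarg_ge0.
  by rewrite -sumEFin; apply: eq_bigr => o _; rewrite Jw EFinM muleC.
(* Adding [L] turns the bound L (x - 1) into L x, so that all the sums have nonnegative terms. *)
rewrite -(@leeD2rE _ L%:E)//.
(* Grouped by the value y of [b], the sum is that of [pr b y] times a quantity which the hypothesis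
   bounds by 1. *)
have gpb : (\esum_(t in [set: T]) ((g (s t) * pr b (b t))%:E * J t) <= 1)%E.
  rewrite (esum_fibers (f := b) (Q := setT))//; last first.
    by move=> t; rewrite mule_ge0 ?lee_fin// mulr_ge0// pr_ge0.
  rewrite -total_mass -[leRHS](eq_esum (a := fun t => (1%:E * J t)%E)); last by move=> t _; rewrite mul1e.
  rewrite (esum_emarg J0 b (h := fun=> 1))//; apply: le_esum => y _; rewrite mul1e emargE.
  rewrite (eq_esum (b := fun t => ((pr b y)%:E * ((g (s t))%:E * J t))%E)); last first.
    by move=> t /= [_ ->]; rewrite /J -!EFinM mulrCA mulrA.
  rewrite esumZ ?pr_ge0//; last by move=> t; rewrite mule_ge0// lee_fin.
  rewrite -[leRHS]mule1 lee_wpmul2l ?lee_fin ?pr_ge0//.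
  by rewrite (_ : [set _ | _] = [set t | b t = y])//; apply/seteqP; split=> t //= [].
apply: (@le_trans _ _ (\esum_(t in [set: T]) ((h (b t))%:E * J t)
    + L%:E * \esum_(t in [set: T]) ((g (s t) * pr b (b t))%:E * J t))%E); last first.
  by rewrite leeD2l// -[leRHS]mule1 lee_wpmul2l// lee_fin ltW.
have {1}-> : L%:E = (\esum_(t in [set: T]) (L%:E * J t))%E.
  by rewrite esumZ ?(ltW L0)// total_mass mule1.
rewrite -esumZ ?(ltW L0)//; last by move=> t; rewrite mule_ge0// lee_fin mulr_ge0// pr_ge0.
rewrite -!esumD; do ?by move=> t _; rewrite ?mule_ge0 ?lee_fin ?log2_ge0 ?mulr_ge0 ?pr_ge0 ?(ltW L0).
apply: le_esum => t _; rewrite /J -!EFinM -!EFinD lee_fin mulrA -!mulrDl.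
have [->|jn] := eqVneq (j t) 0; first by rewrite !mulr0.
have jt : 0 < j t by rewrite lt_def jn j0.
have p0 := pr_gt0 b jt; have gp : 0 < g (s t) by apply: lt_le_trans (g1 _).
rewrite ler_pM2r// /h.
have := log2_sub1 (mulr_gt0 gp p0); rewrite log2M// mulrBl mul1r.
by rewrite -/L => ?; lra.
Qed.

End Density.

(** * The entropy bound for one link *)

Section LinkBound.
Variables (R : realType) (T : choiceType) (j : T -> R).
Let J (x : T) : \bar R := (j x)%:E.
Hypothesis j0 : forall x, 0 <= j x.
Variables (O : finType) (w : O -> R) (s : T -> O).
Hypothesis Jw : forall o, emarg J s o = (w o)%:E.
Hypothesis w1 : \sum_o w o = 1.
Variables (U V W : finType) (u : O -> U) (v : O -> V) (t : O -> W).
Variables (A B C : choiceType) (a : T -> A) (b : T -> B) (c : T -> C).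
Hypothesis Mu : Defs.markov J (fun x => (a x, c x)) (fun x => u (s x))
  (fun x => (v (s x), t (s x))).
Hypothesis Mv : Defs.markov J (fun x => (a x, b x)) (fun x => v (s x))
  (fun x => (u (s x), t (s x))).
Hypothesis Dv : forall x x', 0 < j x -> 0 < j x' ->
  a x = a x' -> b x = b x' -> v (s x) = v (s x').
Hypothesis Dt : forall x x', 0 < j x -> 0 < j x' ->
  b x = b x' -> c x = c x' -> t (s x) = t (s x').

Let J0 : forall x, (0 <= J x)%E := J_ge0 j0.
Let w0 : forall o, 0 <= w o := w_ge0 j0 Jw.
Let Jfin (S : Type) (f : T -> S) y : emarg J f y \is a fin_num := emarg_fin j0 Jw w1 f y.
Let JE (S : Type) (f : T -> S) y : emarg J f y = (pr j f y)%:E := emargE j0 Jw w1 f y.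

Lemma pr_eq (S S' : Type) (f : T -> S) (f' : T -> S') y y' :
  (forall x, f x = y <-> f' x = y') -> pr j f y = pr j f' y'.
Proof. by move=> e; rewrite /pr (emarg_eq _ e). Qed.

Lemma pr_markov (S1 S2 S3 : Type) (f1 : T -> S1) (f2 : T -> S2) (f3 : T -> S3) x y z :
  Defs.markov J f1 f2 f3 ->
  pr j (fun r => (f1 r, f2 r, f3 r)) (x, y, z) * pr j f2 y =
  pr j (fun r => (f1 r, f2 r)) (x, y) * pr j (fun r => (f2 r, f3 r)) (y, z).
Proof. by move=> m; apply: EFin_inj; rewrite !EFinM -!JE. Qed.

Let Duv := dist w (fun o => (u o, v o)).
Let Dvtu := dist w (fun o => ((v o, t o), u o)).

Let law (x : U) (y : A) : R := pr j (fun r => (a r, u (s r))) (y, x) / dist w u x.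

(* The conditional law of [a] given [u] is also the one given [v], hence a common function of both. *)
Let lawv o y : 0 < w o ->
  law (u o) y = pr j (fun r => (a r, v (s r))) (y, v o) / dist w v (v o).
Proof.
(* Coarsening the two privacy statements gives the chains a - u - v and a - v - u; both express the
   same joint probability of a, u and v. *)
move=> wo; have m1 : Defs.markov J a (fun x => u (s x)) (fun x => v (s x)).
  apply: markov_sym; apply: (markov_comp J0 Jfin fst (fa := fun x => (v (s x), t (s x)))).
  by apply: markov_sym; apply: (markov_comp J0 Jfin fst Mu).
have m2 : Defs.markov J a (fun x => v (s x)) (fun x => u (s x)).
  apply: markov_sym; apply: (markov_comp J0 Jfin fst (fa := fun x => (u (s x), t (s x)))).
  by apply: markov_sym; apply: (markov_comp J0 Jfin fst Mv).
have := pr_markov y (u o) (v o) m1; have := pr_markov y (v o) (u o) m2.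
rewrite (pr_dist j0 Jw u) (pr_dist j0 Jw v).
rewrite (pr_dist j0 Jw (fun o => (u o, v o))) (pr_dist j0 Jw (fun o => (v o, u o))).
rewrite (pr_eq (f := fun r => (a r, v (s r), u (s r)))
    (f' := fun r => (a r, u (s r), v (s r))) (y' := (y, u o, v o))); last first.
  by move=> r; split=> -[-> -> ->].
rewrite (dist_eq w0 (f := fun o => (v o, u o))
    (f' := fun o => (u o, v o)) (y' := (u o, v o))); last first.
  by move=> r _; split=> -[-> ->].
have u0 := dist_gt0 w0 u wo; have v0 := dist_gt0 w0 v wo.
have uv0 := dist_gt0 w0 (fun o => (u o, v o)) wo.
rewrite /law; set p3 := pr _ _ _; set pv := pr _ _ _; set pu := pr _ _ _ => e2 e1.
apply: (mulIf (lt0r_neq0 uv0)); rewrite [LHS]mulrAC [RHS]mulrAC -e1 -e2.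
by rewrite !mulfK// gt_eqF.
Qed.

(** [common_ok] asks for functions to [nat], so a law is coded by a value of [u] that has it; the
    choice made by [pick] depends on the law only. *)
Let F (x : U) : nat := pickle [pick x' | `[< law x' = law x >]].

Let F_eq x x' : law x = law x' -> F x = F x'.
Proof. by rewrite /F => ->. Qed.

Let F_law x x' : F x = F x' -> law x = law x'.
Proof.
move=> /(pcan_inj pickleK); case: pickP => [y /asboolP <-|/(_ x)]; last by rewrite asboolT.
by case: pickP => [y' /asboolP <- [->]|].
Qed.

(** By [lawv], any outcome of positive weight with [v o = y] gives the same code. The value 0 is for
    [y] outside the support. *)
Let G (y : V) : nat := if [pick o | (0 < w o) && (v o == y)] is Some o then F (u o) else 0.

Let FG : common_ok w u v F G.
Proof.
move=> o wo; rewrite /G; case: pickP => [i /andP[wi /eqP e]|/(_ o)]; last by rewrite wo eqxx.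
by apply: F_eq; apply/funext => y; rewrite !lawv// e.
Qed.

(** The factor p(q) of the Gibbs weight, read from the value of [v]. *)
Let q (y : V) : R := dist w (fun o => F (u o)) (G y).

Let q_ge0 y : 0 <= q y. Proof. exact: dist_ge0. Qed.

(** On the support the left-hand side is p(q) p(a | v). As p(a | v) is the law shared by all values
    of [u] in the class q, the product is p(a, q), which is at most p(a). *)
Let pr_av_le y z : q z / dist w v z * pr j (fun r => (a r, v (s r))) (y, z) <= pr j a y.
Proof.
have [/eqP v0|v0] := boolP (dist w v z == 0).
  by rewrite v0 invr0 mulr0 mul0r pr_ge0.
have [ o wo e] : exists2 i, 0 < w i & v i = z.
  apply: contrapT => no; move/negP: v0; apply; rewrite /dist big1// => i /eqP iz.
  apply/eqP; rewrite eq_le w0 andbT leNgt; apply/negP => wi; apply: no.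
  by exists i.
rewrite -mulrA [_^-1 * _]mulrC -e -lawv// /q -(FG wo).
have -> : dist w (fun o => F (u o)) (F (u o)) = \sum_(x : U | F x == F (u o)) dist w u x.
  rewrite /dist (exchange_big_dep xpredT)//= big_mkcond; apply: eq_bigr => o' _.
  case: ifPn => Fo.
    by rewrite (big_pred1 (u o'))// => x; rewrite /= [u o' == x]eq_sym;
      have [->|_] := eqVneq x (u o'); rewrite ?Fo ?andbF.
  by rewrite big1// => x /andP[/eqP Fx /eqP e']; rewrite -e' in Fx; rewrite Fx eqxx in Fo.
rewrite mulr_suml.
have le1 : \sum_(x : U) pr j (fun r => (a r, u (s r))) (y, x) <= pr j a y.
  rewrite -lee_fin -sumEFin -JE.
  rewrite (emarg_comp J0 (fun r => (a r, u (s r))) fst).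
  rewrite [leRHS](esum_fibers (f := snd) (Q := setT))//; last by move=> i; exact: emarg_ge0.
  rewrite (_ : [set: U] = [set x | xpredT x]); last by apply/seteqP; split.
  rewrite esum_finType; last by move=> x; apply: esum_ge0 => ? _; exact: emarg_ge0.
  apply: lee_sum => x _; rewrite -JE
    -[leLHS](esum_set1 (a := fun i => emarg J (fun r => (a r, u (s r))) i)); last exact: emarg_ge0.
  rewrite (_ : [set i | _] = [set (y, x)])//.
  by apply/seteqP; split=> [[y' x'] /= [-> ->]//|_ ->].
apply: le_trans le1; rewrite big_mkcond; apply: ler_sum => x _.
case: ifPn => [/eqP /F_law <-|_]; last exact: pr_ge0.
rewrite /law mulrCA; have [->|u0] := eqVneq (dist w u x) 0; first by rewrite mul0r mulr0 pr_ge0.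
by rewrite mulfV// mulr1.
Qed.

(** The value 1 off the support keeps [1 <= g o] everywhere, as [Hdisc_ge] asks. *)
Let g o : R := if 0 < w o then q (v o) * Duv (u o, v o) / (dist w v (v o) * Dvtu ((v o, t o), u o))
  else 1.

(** p(v) is at most p(q) because q is a function of [v] on the support, and p(u, v, t) is at most
    p(u, v). *)
Let g_ge1 o : 1 <= g o.
Proof.
rewrite /g; case: ifPn => // wo.
have v0 := dist_gt0 w0 v wo; have vtu0 := dist_gt0 w0 (fun o => ((v o, t o), u o)) wo.
rewrite ler_pdivlMr ?mulr_gt0// mul1r ler_pM ?(ltW v0) ?(ltW vtu0)//.
  by apply: dist_le => // o' wo' <-; exact: FG.
by apply: dist_le => // o' wo' [-> _ ->].
Qed.

(** With [b = y] fixed, [c] determines [t] and [a] determines [v]. By privacy p(t | u, v, a, c) =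
    p(t | u, v), so p(u, v) / p(u, v, t) cancels when [t] is summed out. The remaining factor p(q) /
    p(v) is handled by [pr_av_le], and p(a) sums to 1. *)
Let g_bound y : (\esum_(x in [set x | b x = y]) ((g (s x))%:E * J x) <= 1)%E.
Proof.
(* [relv] and [relt] say which values of [v] and [t] can occur with [b = y] and the given [a] and
   [c] respectively; [Dv] and [Dt] make them single-valued. *)
pose relv (y1 : A) (z : V) := exists x, [/\ 0 < j x, a x = y1, b x = y & v (s x) = z].
pose relt (y1 : U * V * (A * C)) (z : W) := exists x, [/\ 0 < j x, b x = y, c x = y1.2.2 & t (s x) = z].
pose f x := ((u (s x), v (s x)), (a x, c x)).
pose l (y1 : U * V * (A * C)) : R := if `[< relv y1.2.1 y1.1.2 >] then q y1.1.2 / dist w v y1.1.2 else 0.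
pose k (y1 : U * V * (A * C)) (z : W) : R := l y1 * (Duv y1.1 / Dvtu ((y1.1.2, z), y1.1.1)).
have l0 y1 : 0 <= l y1 by rewrite /l; case: ifP => // _; rewrite divr_ge0// dist_ge0.
have k0 y1 z : 0 <= k y1 z by rewrite mulr_ge0// divr_ge0// dist_ge0.
(* The event [b x = y] is enlarged to compatibility of the other variables with [y]. *)
apply: (@le_trans _ _ (\esum_(x in [set x | relt (f x) (t (s x))]) ((k (f x) (t (s x)))%:E * J x)%E)).
  rewrite esum_mkcond [leRHS]esum_mkcond; apply: le_esum => x _.
  case: ifPn => [/set_mem /= bx|_]; last by case: ifP => // _; rewrite mule_ge0 ?lee_fin.
  have [jx|jx] := eqVneq (j x) 0; first by rewrite /J jx mule0; case: ifP => // _; rewrite mule0.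
  have {}jx : 0 < j x by rewrite lt_def jx j0.
  rewrite mem_set; last by exists x.
  rewrite /k /l asboolT; last by exists x.
  rewrite /g (w_gt0 Jw)//= /f /= lee_wpmul2r// lee_fin invfM.
  by rewrite le_eqVlt; apply/orP; left; apply/eqP; ring.
(* First summation: over [t], with u, v, a, c fixed. *)
apply: (@le_trans _ _ (\esum_(x in [set: T]) ((l (f x))%:E * J x)%E)).
  apply: (esum_determined_le J0 k0 l0).
    move=> y1 z z' [x [jx bx cx <-]] [x' [jx' bx' cx' <-]].
    by apply: Dt => //; rewrite ?bx ?cx.
  move=> [[u1 v1] [a1 c1]] z _; rewrite !JE -!EFinM lee_fin.
  rewrite /k /= -mulrA ler_wpM2l//.
  have [d0|d0] := eqVneq (Dvtu (v1, z, u1)) 0; first by rewrite d0 invr0 mulr0 mul0r pr_ge0.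
  have mu := pr_markov (a1, c1) u1 (v1, z) Mu.
  have mu' : Defs.markov J (fun x => (a x, c x)) (fun x => u (s x)) (fun x => v (s x)).
    apply: markov_sym; apply: (markov_comp J0 Jfin fst (fa := fun x => (v (s x), t (s x)))).
    exact: markov_sym.
  have := pr_markov (a1, c1) u1 v1 mu'; move: mu.
  rewrite (pr_dist j0 Jw u) (pr_dist j0 Jw (fun o => (u o, v o))).
  rewrite (pr_dist j0 Jw (fun o => (u o, (v o, t o)))).
  rewrite (pr_eq (f := fun r => (a r, c r, u (s r), (v (s r), t (s r))))
      (f' := fun r => (f r, t (s r))) (y' := ((u1, v1), (a1, c1), z))); last first.
    by move=> r; rewrite /f; split=> -[-> -> -> -> ->].
  rewrite (pr_eq (f := fun r => (a r, c r, u (s r), v (s r)))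
      (f' := f) (y' := ((u1, v1), (a1, c1)))); last first.
    by move=> r; rewrite /f; split=> -[-> -> -> ->].
  rewrite (dist_eq w0 (f := fun o => (u o, (v o, t o)))
      (f' := fun o => ((v o, t o), u o)) (y' := (v1, z, u1))); last first.
    by move=> r _; split=> -[-> -> ->].
  rewrite -/Dvtu -/Duv.
  have du : 0 < dist w u u1.
    apply: lt_le_trans (_ : Dvtu (v1, z, u1) <= _); last by apply: dist_le => // o _ [].
    by rewrite lt_def d0 dist_ge0.
  set p1 := pr _ _ _; set p2 := pr _ _ _; set p3 := pr _ _ _ => e1 e2.
  suff -> : Duv (u1, v1) / Dvtu (v1, z, u1) * p1 = p3 by [].
  apply: (mulIf (lt0r_neq0 du)); rewrite e2 -[LHS]mulrA. rewrite e1.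
  by rewrite [p2 * _]mulrC !mulrA mulfVK// mulrC.
(* Second summation: over [v], with a fixed. *)
rewrite (eq_esum (b := fun x => if x \in [set x | relv (a x) (v (s x))] then
   ((q (v (s x)) / dist w v (v (s x)))%:E * J x)%E else 0%E)); last first.
  move=> x _; rewrite /l /=; case: asboolP => h; first by rewrite mem_set.
  by rewrite memNset// mul0e.
rewrite -esum_mkcond.
rewrite -[leRHS](total_mass j0 Jw w1).
rewrite -[leRHS](eq_esum (a := fun x => (1%:E * J x)%E)); last by move=> x _; rewrite mul1e.
apply: (esum_determined_le J0 (f := a) (g := fun x => v (s x)) (k := fun _ z => q z / dist w v z)
  (l := fun=> 1)) => //.
- by move=> _ z; rewrite divr_ge0// dist_ge0.
- move=> y1 z z' [x [jx ax bx <-]] [x' [jx' ax' bx' <-]].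
  by apply: Dv => //; rewrite ?ax ?bx.
- by move=> y1 z _; rewrite mul1e !JE -EFinM lee_fin pr_av_le.
Qed.

Theorem link_bound :
  ((RI w u v + Hcond w (fun o => (v o, t o)) u)%:E <= Hdisc J b)%E.
Proof.
apply: le_trans (Hdisc_ge j0 Jw w1 g_ge1 g_bound); rewrite lee_fin.
apply: le_trans (RI_Hcond_le w0 _ FG) _; apply: ler_sum => o _.
have [->|wn] := eqVneq (w o) 0; first by rewrite !mul0r.
by rewrite /g lt_def wn w0.
Qed.

End LinkBound.

(** * Views determine inputs and output *)

Section Swap.
Variables (R : realType) (T : choiceType) (J : T -> \bar R).
Hypothesis J0 : forall t, (0 <= J t)%E.
Hypothesis Jfin : forall (U : Type) (f : T -> U) y, emarg J f y \is a fin_num.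

(** Serves to bring the privacy statements into the order of variables in [link_bound]. *)
Lemma markov_swapl (A A' : choiceType) (B C : Type) (f : T -> A) (f' : T -> A')
    (g : T -> B) (h : T -> C) :
  Defs.markov J (fun t => (f t, f' t)) g h -> Defs.markov J (fun t => (f' t, f t)) g h.
Proof. exact: (markov_comp J0 Jfin (fun x => (x.2, x.1))). Qed.

Lemma markov_swapr (C C' : choiceType) (A B : Type) (f : T -> A)
    (g : T -> B) (h : T -> C) (h' : T -> C') :
  Defs.markov J f g (fun t => (h t, h' t)) -> Defs.markov J f g (fun t => (h' t, h t)).
Proof. by move=> /markov_sym/markov_swapl/markov_sym. Qed.

End Swap.

Lemma Hcond_swap (R : realType) (O : finType) (w : O -> R) (U V W : eqType)
    (u : O -> U) (v : O -> V) (t : O -> W) : (forall o, 0 <= w o) ->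
  Hcond w (fun o => (v o, t o)) u = Hcond w (fun o => (t o, v o)) u.
Proof.
move=> w0; apply: eq_bigr => o _; congr (_ * - log2 (_ / _)).
by apply: dist_eq => // o' _; split=> -[-> -> ->].
Qed.

(** Summing over z identifies the two constants. *)
Lemma proportional_pmf (R : realType) (Z : finType) (p p' : Z -> R) (k k' : R) :
  \sum_z p z = 1 -> \sum_z p' z = 1 -> 0 < k ->
  (forall z, k * p z = k' * p' z) -> p =1 p'.
Proof.
move=> p1 p1' k0 e.
have kk : k = k'.
  by rewrite -[k]mulr1 -[k']mulr1 -{1}p1 -p1' !mulr_sumr; exact: eq_bigr.
by move=> z; apply: (mulfI (lt0r_neq0 k0)); rewrite e kk.
Qed.

(** * The joint law of a secure protocol, and what two links reveal *)

Section Determination.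
Variables (R : realType) (X Y Z : finType) (pXY : X -> Y -> R) (pZ : X -> Y -> Z -> R).
Hypothesis HpXY : is_pmf2 pXY.
Hypothesis HpZ : is_cond_pmf pZ.
Hypothesis Hnf : normal_form pXY pZ.
Variable P : protocol R X Y Z.
Hypothesis HP : secure pXY pZ P.
Variables (al : X -> msg -> msg -> R) (be : Y -> msg -> msg -> R) (ga : msg -> msg -> R).
Hypothesis al0 : forall x m m', 0 <= al x m m'.
Hypothesis be0 : forall y m m', 0 <= be y m m'.
Hypothesis ga0 : forall m m', 0 <= ga m m'.
Hypothesis factor : forall x y m,
  final_p P x y m = (al x m.1.1 m.2 * be y m.1.1 m.1.2 * ga m.1.2 m.2)%:E.

Local Notation space := ((X * Y * Z) * (msg * msg * msg))%type.

Definition density (o : space) : R :=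
  pXY (oX o) (oY o) *
  (al (oX o) (oM12 o) (oM31 o) * be (oY o) (oM12 o) (oM23 o) * ga (oM23 o) (oM31 o)) *
  output P (oM23 o) (oM31 o) (oZ o).

Let J (o : space) : \bar R := (density o)%:E.
Let w := wXYZ pXY pZ.

Lemma jointPE : jointP P pXY = J.
Proof. by apply/funext => o; rewrite /jointP factor -!EFinM. Qed.

Let pXY0 x y : 0 <= pXY x y. Proof. by case: HpXY. Qed.
Let out0 m m' z : 0 <= output P m m' z.
Proof. by case: HP => -[_ [_ [_ [_ [_ [_ /(_ m m')[]]]]]]]. Qed.

Lemma density_ge0 o : 0 <= density o.
Proof. by rewrite /density !mulr_ge0. Qed.

Lemma density_gt0 o : 0 < density o ->
  [/\ 0 < pXY (oX o) (oY o), 0 < al (oX o) (oM12 o) (oM31 o),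
      0 < be (oY o) (oM12 o) (oM23 o) & 0 < output P (oM23 o) (oM31 o) (oZ o)].
Proof.
move=> /lt0r_neq0; rewrite /density !mulf_eq0 !negb_or -!andbA => /and5P[? ? ? _ ?].
by rewrite !lt_def; split; apply/andP.
Qed.

(** This is correctness of the protocol where [pXY] is positive; elsewhere both sides vanish. *)
Lemma emarg_XYZ o : emarg J fst o = (w o)%:E.
Proof.
rewrite /emarg (reindex_esum [set: msg * msg * msg] _ (fun m => (o, m))); last first.
  split.
  - by move=> m _.
  - by move=> m m' _ _ [].
  - by case=> o' m /= <-; exists m.
case: o => [[x y] z]; rewrite /w /wXYZ /= EFinM.
have [p0|p0] := eqVneq (pXY x y) 0.
  by rewrite p0 mul0e esum1// => m _; rewrite /J /density /oX /oY /= p0 !mul0r.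
case: HP => _ [_ [corr _]]; rewrite -corr ?lt_def ?p0 ?pXY0//.
rewrite -esumZ//; last by move=> m; rewrite factor -EFinM lee_fin !mulr_ge0.
by apply: eq_esum => m _; rewrite factor -!EFinM /J /density /oX /oY /oZ /oM12 /oM23 /oM31 /= !mulrA.
Qed.

Lemma wXYZ_sum : \sum_o w o = 1.
Proof.
rewrite /w /wXYZ -(pair_bigA _ (fun xy z => pXY xy.1 xy.2 * pZ xy.1 xy.2 z))/=.
rewrite -(pair_bigA _ (fun x y => \sum_z pXY x y * pZ x y z))/=.
case: HpXY => _ <-; apply: eq_bigr => x _; apply: eq_bigr => y _.
by rewrite -mulr_sumr (proj2 HpZ) mulr1.
Qed.

Let J0 : forall o, (0 <= J o)%E := J_ge0 density_ge0.
Let Jfin (S : Type) (f : space -> S) y : emarg J f y \is a fin_num :=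
  emarg_fin density_ge0 emarg_XYZ wXYZ_sum f y.
Let JE (S : Type) (f : space -> S) y : emarg J f y = (pr density f y)%:E :=
  emargE density_ge0 emarg_XYZ wXYZ_sum f y.
Let mk := pr_markov density_ge0 emarg_XYZ wXYZ_sum.

Lemma privacyX : Defs.markov J (fun o => (oM12 o, oM31 o)) (@oX X Y Z) (fun o => (oY o, oZ o)).
Proof. by rewrite -jointPE; case: HP => _ [_ [_ []]]. Qed.
Lemma privacyY : Defs.markov J (fun o => (oM12 o, oM23 o)) (@oY X Y Z) (fun o => (oX o, oZ o)).
Proof. by rewrite -jointPE; case: HP => _ [_ [_ [_ []]]]. Qed.
Lemma privacyZ : Defs.markov J (fun o => (oM23 o, oM31 o)) (@oZ X Y Z) (fun o => (oX o, oY o)).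
Proof. by rewrite -jointPE; case: HP => _ [_ [_ [_ []]]]. Qed.

(** Once x, y, z and two transcripts are fixed, only the third transcript is free. [e] and [e'] run
    through it, and proportional densities sum to proportional marginals. *)
Lemma exchange (S : Type) (f : space -> S) (s s' : S) (e e' : msg -> space) (k k' : R) :
  0 <= k -> 0 <= k' ->
  set_bij [set: msg] [set o | f o = s] e -> set_bij [set: msg] [set o | f o = s'] e' ->
  (forall m, k * density (e m) = k' * density (e' m)) ->
  k * pr density f s = k' * pr density f s'.
Proof.
move=> k0 k0' bij bij' eq; apply: EFin_inj; rewrite !EFinM -!JE /emarg.
rewrite (reindex_esum _ _ _ _ bij) (reindex_esum _ _ _ _ bij') -!esumZ//.
by apply: eq_esum => m _; rewrite /J -!EFinM eq.
Qed.

Let pr_fst o : pr density fst o = w o.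
Proof. by rewrite /pr emarg_XYZ. Qed.

(** Privacy in the form used below: the joint law of view and variables is [w] times a factor that
    involves neither y nor z. *)
Let viewX m12 m31 x y z :
  pr density (fun o => ((oM12 o, oM31 o), oX o, (oY o, oZ o))) ((m12, m31), x, (y, z)) *
    dist w (fun o => o.1.1) x =
  pr density (fun o => ((oM12 o, oM31 o), oX o)) ((m12, m31), x) * w (x, y, z).
Proof.
rewrite -(pr_dist density_ge0 emarg_XYZ (fun o => o.1.1)) (mk _ _ _ privacyX) -pr_fst.
congr (_ * _); apply: pr_eq => -[[[x' y'] z'] m] /=.
by rewrite /oX /oY /oZ /=; split=> -[-> -> ->].
Qed.

Let viewY m12 m23 x y z :
  pr density (fun o => ((oM12 o, oM23 o), oY o, (oX o, oZ o))) ((m12, m23), y, (x, z)) *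
    dist w (fun o => o.1.2) y =
  pr density (fun o => ((oM12 o, oM23 o), oY o)) ((m12, m23), y) * w (x, y, z).
Proof.
rewrite -(pr_dist density_ge0 emarg_XYZ (fun o => o.1.2)) (mk _ _ _ privacyY) -pr_fst.
congr (_ * _); apply: pr_eq => -[[[x' y'] z'] m] /=.
by rewrite /oX /oY /oZ /=; split=> -[-> -> ->].
Qed.

Let viewZ m23 m31 x y z :
  pr density (fun o => ((oM23 o, oM31 o), oZ o, (oX o, oY o))) ((m23, m31), z, (x, y)) *
    dist w (fun o => o.2) z =
  pr density (fun o => ((oM23 o, oM31 o), oZ o)) ((m23, m31), z) * w (x, y, z).
Proof.
rewrite -(pr_dist density_ge0 emarg_XYZ (fun o => o.2)) (mk _ _ _ privacyZ) -pr_fst.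
congr (_ * _); apply: pr_eq => -[[[x' y'] z'] m] /=.
by rewrite /oX /oY /oZ /=; split=> -[-> -> ->].
Qed.

(** With the view (m12, m31) and y fixed, replacing x by x' changes the density by a ratio of [pXY]
    and [al] that does not involve z or m23. By privacy p(z | x, y) and p(z | x', y) are then
    proportional in z, hence equal, and the normal form applies. *)
Lemma determineX o o' : 0 < density o -> 0 < density o' ->
  oM12 o = oM12 o' -> oM31 o = oM31 o' -> oX o = oX o'.
Proof.
move=> do0 do1 e12 e31; case: Hnf => + _ _; apply=> y + pxy px'y.
have [_ a0 _ _] := density_gt0 do0; have [_ a1 _ _] := density_gt0 do1.
have A0 := pr_gt0 density_ge0 emarg_XYZ wXYZ_sum (fun o => ((oM12 o, oM31 o), oX o)) do0.
have A1 := pr_gt0 density_ge0 emarg_XYZ wXYZ_sum (fun o => ((oM12 o, oM31 o), oX o)) do1.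
have D0 := dist_gt0 (w_ge0 density_ge0 emarg_XYZ) (fun o => o.1.1) (w_gt0 emarg_XYZ do0).
have D1 := dist_gt0 (w_ge0 density_ge0 emarg_XYZ) (fun o => o.1.1) (w_gt0 emarg_XYZ do1).
rewrite /= -/(oX o) in D0; rewrite /= -/(oX o') in D1; rewrite -e12 -e31 in a1 A1.
move: (oX o) (oX o') (oM12 o) (oM31 o) pxy px'y a0 a1 A0 A1 D0 D1.
move=> x x' m12 m31 pxy px'y a0 a1 A0 A1 D0 D1 {o o' do0 do1 e12 e31}.
have K0 := mulr_gt0 pxy a0; have K1 := mulr_gt0 px'y a1.
set A := pr _ _ _ in A0; set A' := pr _ _ _ in A1.
set D := dist _ _ _ in D0; set D' := dist _ _ _ in D1.
(* The weights [pXY * al] of x and x' are crossed, as in [exchange]; [A / D] and [A' / D'] are the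
   probabilities of the view given x and x'. *)
apply: (@proportional_pmf _ _ _ _ (pXY x' y * al x' m12 m31 * (A / D) * pXY x y)
  (pXY x y * al x m12 m31 * (A' / D') * pXY x' y)); [exact: (proj2 HpZ)..| |].
  by rewrite !mulr_gt0 ?invr_gt0.
move=> z.
have := @exchange _ (fun o => ((oM12 o, oM31 o), oX o, (oY o, oZ o))) ((m12, m31), x, (y, z))
  ((m12, m31), x', (y, z)) (fun m => ((x, y, z), ((m12, m), m31)))
  (fun m => ((x', y, z), ((m12, m), m31))) _ _ (ltW K1) (ltW K0).
set p := pr _ _ _; set p' := pr _ _ _.
have -> : p = A / D * w (x, y, z).
  by apply: (mulIf (lt0r_neq0 D0)); rewrite viewX -/A mulrAC mulfVK ?gt_eqF.
have -> : p' = A' / D' * w (x', y, z).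
  by apply: (mulIf (lt0r_neq0 D1)); rewrite viewX -/A' mulrAC mulfVK ?gt_eqF.
rewrite /w /wXYZ /= => h; rewrite -!mulrA in h *; apply: h.
- split=> [m _|m m' _ _ []|[[[? ?] ?] [[? m] ?]]]//=.
  by rewrite /oX /oY /oZ /oM12 /oM31 /= => -[-> -> -> -> ->]; exists m.
- split=> [m _|m m' _ _ []|[[[? ?] ?] [[? m] ?]]]//=.
  by rewrite /oX /oY /oZ /oM12 /oM31 /= => -[-> -> -> -> ->]; exists m.
- by move=> m; rewrite /density /oX /oY /oZ /oM12 /oM23 /oM31 /=; ring.
Qed.

(** As for [determineX], with [be] in place of [al] and m31 as the free transcript. *)
Lemma determineY o o' : 0 < density o -> 0 < density o' ->
  oM12 o = oM12 o' -> oM23 o = oM23 o' -> oY o = oY o'.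
Proof.
move=> do0 do1 e12 e23; case: Hnf => _ + _; apply=> x + pxy pxy'.
have [_ _ a0 _] := density_gt0 do0; have [_ _ a1 _] := density_gt0 do1.
have A0 := pr_gt0 density_ge0 emarg_XYZ wXYZ_sum (fun o => ((oM12 o, oM23 o), oY o)) do0.
have A1 := pr_gt0 density_ge0 emarg_XYZ wXYZ_sum (fun o => ((oM12 o, oM23 o), oY o)) do1.
have D0 := dist_gt0 (w_ge0 density_ge0 emarg_XYZ) (fun o => o.1.2) (w_gt0 emarg_XYZ do0).
have D1 := dist_gt0 (w_ge0 density_ge0 emarg_XYZ) (fun o => o.1.2) (w_gt0 emarg_XYZ do1).
rewrite /= -/(oY o) in D0; rewrite /= -/(oY o') in D1; rewrite -e12 -e23 in a1 A1.
move: (oY o) (oY o') (oM12 o) (oM23 o) pxy pxy' a0 a1 A0 A1 D0 D1.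
move=> y y' m12 m23 pxy pxy' a0 a1 A0 A1 D0 D1 {o o' do0 do1 e12 e23}.
have K0 := mulr_gt0 pxy a0; have K1 := mulr_gt0 pxy' a1.
set A := pr _ _ _ in A0; set A' := pr _ _ _ in A1.
set D := dist _ _ _ in D0; set D' := dist _ _ _ in D1.
apply: (@proportional_pmf _ _ _ _ (pXY x y' * be y' m12 m23 * (A / D) * pXY x y)
  (pXY x y * be y m12 m23 * (A' / D') * pXY x y')); [exact: (proj2 HpZ)..| |].
  by rewrite !mulr_gt0 ?invr_gt0.
move=> z.
have := @exchange _ (fun o => ((oM12 o, oM23 o), oY o, (oX o, oZ o))) ((m12, m23), y, (x, z))
  ((m12, m23), y', (x, z)) (fun m => ((x, y, z), ((m12, m23), m)))
  (fun m => ((x, y', z), ((m12, m23), m))) _ _ (ltW K1) (ltW K0).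
set p := pr _ _ _; set p' := pr _ _ _.
have -> : p = A / D * w (x, y, z).
  by apply: (mulIf (lt0r_neq0 D0)); rewrite viewY -/A mulrAC mulfVK ?gt_eqF.
have -> : p' = A' / D' * w (x, y', z).
  by apply: (mulIf (lt0r_neq0 D1)); rewrite viewY -/A' mulrAC mulfVK ?gt_eqF.
rewrite /w /wXYZ /= => h; rewrite -!mulrA in h *; apply: h.
- split=> [m _|m m' _ _ []|[[[? ?] ?] [[? ?] m]]]//=.
  by rewrite /oX /oY /oZ /oM12 /oM23 /= => -[-> -> -> -> ->]; exists m.
- split=> [m _|m m' _ _ []|[[[? ?] ?] [[? ?] m]]]//=.
  by rewrite /oX /oY /oZ /oM12 /oM23 /= => -[-> -> -> -> ->]; exists m.
- by move=> m; rewrite /density /oX /oY /oZ /oM12 /oM23 /oM31 /=; ring.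
Qed.

(** Replacing z by z' changes the density by a ratio of [output] values alone, independent of x, y
    and m12. With privacy this is the proportionality in [equivZ]. *)
Lemma determineZ o o' : 0 < density o -> 0 < density o' ->
  oM23 o = oM23 o' -> oM31 o = oM31 o' -> oZ o = oZ o'.
Proof.
move=> do0 do1 e23 e31; case: Hnf => _ _; apply.
have [_ _ _ a0] := density_gt0 do0; have [_ _ _ a1] := density_gt0 do1.
have A0 := pr_gt0 density_ge0 emarg_XYZ wXYZ_sum (fun o => ((oM23 o, oM31 o), oZ o)) do0.
have A1 := pr_gt0 density_ge0 emarg_XYZ wXYZ_sum (fun o => ((oM23 o, oM31 o), oZ o)) do1.
have D0 := dist_gt0 (w_ge0 density_ge0 emarg_XYZ) (fun o => o.2) (w_gt0 emarg_XYZ do0).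
have D1 := dist_gt0 (w_ge0 density_ge0 emarg_XYZ) (fun o => o.2) (w_gt0 emarg_XYZ do1).
rewrite /= -/(oZ o) in D0; rewrite /= -/(oZ o') in D1; rewrite -e23 -e31 in a1 A1.
move: (oZ o) (oZ o') (oM23 o) (oM31 o) a0 a1 A0 A1 D0 D1.
move=> z z' m23 m31 a0 a1 A0 A1 D0 D1 {o o' do0 do1 e23 e31}.
set A := pr _ _ _ in A0; set A' := pr _ _ _ in A1.
set D := dist _ _ _ in D0; set D' := dist _ _ _ in D1.
set t := output _ _ _ _ in a0; set t' := output _ _ _ _ in a1.
have c0 : 0 < t' * (A / D) by rewrite mulr_gt0// divr_gt0.
(* The relation between p(z | x, y) and p(z' | x, y) has coefficients [t' * A / D] and
   [t * A' / D']; the witness is their quotient. *)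
exists (t * (A' / D') / (t' * (A / D))); first by rewrite divr_ge0 ?(ltW c0)// !mulr_ge0 ?invr_ge0// ltW.
move=> x y pxy.
have := @exchange _ (fun o => ((oM23 o, oM31 o), oZ o, (oX o, oY o))) ((m23, m31), z, (x, y))
  ((m23, m31), z', (x, y)) (fun m => ((x, y, z), ((m, m23), m31)))
  (fun m => ((x, y, z'), ((m, m23), m31))) _ _ (ltW a1) (ltW a0).
set p := pr _ _ _; set p' := pr _ _ _.
have -> : p = A / D * w (x, y, z).
  by apply: (mulIf (lt0r_neq0 D0)); rewrite viewZ -/A mulrAC mulfVK ?gt_eqF.
have -> : p' = A' / D' * w (x, y, z').
  by apply: (mulIf (lt0r_neq0 D1)); rewrite viewZ -/A' mulrAC mulfVK ?gt_eqF.
rewrite /w /wXYZ /= !mulrA => h.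
rewrite mulrA in c0; suff e : t' * A / D * pZ x y z = t * A' / D' * pZ x y z'.
  by rewrite mulrAC -e mulrAC mulfV ?gt_eqF// mul1r.
apply: (mulfI (lt0r_neq0 pxy)).
transitivity (t' * A / D * pXY x y * pZ x y z); first by ring.
transitivity (t * A' / D' * pXY x y * pZ x y z'); last by ring.
apply: h.
- split=> [m _|m m' _ _ []|[[[? ?] ?] [[m ?] ?]]]//=.
  by rewrite /oX /oY /oZ /oM23 /oM31 /= => -[-> -> -> -> ->]; exists m.
- split=> [m _|m m' _ _ []|[[[? ?] ?] [[m ?] ?]]]//=.
  by rewrite /oX /oY /oZ /oM23 /oM31 /= => -[-> -> -> -> ->]; exists m.
- by move=> m; rewrite /t /t' /density /oX /oY /oZ /oM12 /oM23 /oM31 /=; ring.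
Qed.

End Determination.

(** * Six instances of the link bound, two for each link *)

Theorem theorem1 (R : realType) (X Y Z : finType)
    (pXY : X -> Y -> R) (pZ : X -> Y -> Z -> R)
    (HpXY : is_pmf2 pXY) (HpZ : is_cond_pmf pZ)
    (Hnf : normal_form pXY pZ)
    (P : protocol R X Y Z) (HP : secure pXY pZ P) :
  let w := wXYZ pXY pZ in
  let fX := fun o : X * Y * Z => o.1.1 in
  let fY := fun o : X * Y * Z => o.1.2 in
  let fZ := fun o : X * Y * Z => o.2 in
  let J := jointP P pXY in
  [/\ (Hdisc J (@oM23 X Y Z) >=
         (Num.max (RI w fX fZ) (RI w fX fY)
          + Hcond w (fun o => (fY o, fZ o)) fX)%:E)%E,
      (Hdisc J (@oM31 X Y Z) >=
         (Num.max (RI w fY fZ) (RI w fX fY)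
          + Hcond w (fun o => (fX o, fZ o)) fY)%:E)%E &
      (Hdisc J (@oM12 X Y Z) >=
         (Num.max (RI w fX fZ) (RI w fY fZ)
          + Hcond w (fun o => (fX o, fY o)) fZ)%:E)%E].
Proof.
have [okP _] := HP; have [al [be [ga [al0 be0 ga0 factor]]]] := final_p_factor okP.
move=> w fX fY fZ J.
have d0 := density_ge0 HpXY HP al0 be0 ga0.
have Jw := emarg_XYZ HpXY HP al0 be0 ga0 factor.
have w1 := wXYZ_sum HpXY HpZ.
have JE : J = (fun o => (density pXY P al be ga o)%:E) := jointPE pXY factor.
have J0 := J_ge0 d0; have Jfin := fun S => @emarg_fin _ _ _ d0 _ _ _ Jw w1 S.
have w0 : forall o, 0 <= w o := w_ge0 d0 Jw.
have mX := privacyX HP factor; have mY := privacyY HP factor; have mZ := privacyZ HP factor.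
have dX := determineX HpXY HpZ Hnf HP al0 be0 ga0 factor.
have dY := determineY HpXY HpZ Hnf HP al0 be0 ga0 factor.
have dZ := determineZ HpXY HpZ Hnf HP al0 be0 ga0 factor.
have sl := markov_swapl J0 Jfin; have sr := markov_swapr J0 Jfin.
have maxE (r r' h : R) (e : \bar R) : ((r + h)%:E <= e)%E -> ((r' + h)%:E <= e)%E ->
    ((Num.max r r' + h)%:E <= e)%E by rewrite /Num.max; case: ifP.
(* In each instance [u] belongs to the party that is not an end of the link [b], and [v] to one of
   its two ends; the two choices of [v] give the two terms of the maximum. *)
rewrite JE; split; apply: maxE.
- rewrite Hcond_swap//.
  apply: (link_bound d0 Jw w1 (u := fX) (v := fZ) (t := fY)
    (a := @oM31 X Y Z) (b := @oM23 X Y Z) (c := @oM12 X Y Z)).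
  + exact: (sr _ _ _ _ _ _ _ _ (sl _ _ _ _ _ _ _ _ mX)).
  + exact: (sl _ _ _ _ _ _ _ _ mZ).
  + by move=> o o' jo jo' e1 e2; exact: dZ.
  + by move=> o o' jo jo' e1 e2; exact: dY.
- apply: (link_bound d0 Jw w1 (u := fX) (v := fY) (t := fZ)
    (a := @oM12 X Y Z) (b := @oM23 X Y Z) (c := @oM31 X Y Z)).
  + exact: mX.
  + exact: mY.
  + exact: dY.
  + exact: dZ.
- rewrite Hcond_swap//.
  apply: (link_bound d0 Jw w1 (u := fY) (v := fZ) (t := fX)
    (a := @oM23 X Y Z) (b := @oM31 X Y Z) (c := @oM12 X Y Z)).
  + exact: (sr _ _ _ _ _ _ _ _ (sl _ _ _ _ _ _ _ _ mY)).
  + exact: (sr _ _ _ _ _ _ _ _ mZ).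
  + exact: dZ.
  + by move=> o o' jo jo' e1 e2; exact: dX.
- rewrite (RI_sym w0 fX fY).
  apply: (link_bound d0 Jw w1 (u := fY) (v := fX) (t := fZ)
    (a := @oM12 X Y Z) (b := @oM31 X Y Z) (c := @oM23 X Y Z)).
  + exact: mY.
  + exact: mX.
  + exact: dX.
  + by move=> o o' jo jo' e1 e2; exact: dZ.
- rewrite (RI_sym w0 fX fZ).
  apply: (link_bound d0 Jw w1 (u := fZ) (v := fX) (t := fY)
    (a := @oM31 X Y Z) (b := @oM12 X Y Z) (c := @oM23 X Y Z)).
  + exact: (sl _ _ _ _ _ _ _ _ mZ).
  + exact: (sr _ _ _ _ _ _ _ _ (sl _ _ _ _ _ _ _ _ mX)).
  + by move=> o o' jo jo' e1 e2; exact: dX.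
  + exact: dY.
- rewrite (RI_sym w0 fY fZ) Hcond_swap//.
  apply: (link_bound d0 Jw w1 (u := fZ) (v := fY) (t := fX)
    (a := @oM23 X Y Z) (b := @oM12 X Y Z) (c := @oM31 X Y Z)).
  + exact: (sr _ _ _ _ _ _ _ _ mZ).
  + exact: (sr _ _ _ _ _ _ _ _ (sl _ _ _ _ _ _ _ _ mY)).
  + by move=> o o' jo jo' e1 e2; exact: dY.
  + exact: dX.
Qed.
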